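(* Let $d\geq 2$ and let $F$ be a compact convex set in $\mathbb{R}^{d-1}$ with ${\sf Vol}_{d-1}(F)=1$. Let $M$ be any unit mountain with floor $F$, i.e. $M={\sf CH}((F\times\{0\})\cup\{z\})$ for some $z\in\mathbb{R}^d$ with $z_d=d$. Then for every $K\in{\sf CCSF}(F)$, \[Q_M(2)\leq Q_K(2)<1.\] Moreover, for every $\alpha>0$ there exists $K\in{\sf CCSF}(F)$ with $Q_K(2)\geq 1-\alpha$, and there is no $K\in{\sf CCSF}(F)$ with $Q_K(2)=1$.
   Context: A compact convex set $K\subset\mathbb{R}^d$ has floor $F$ if $K$ is contained in the half-space $\{x_d\geq 0\}$ and $K\cap(\mathbb{R}^{d-1}\times\{0\})=F\times\{0\}$. ${\sf CCSF}(F)$ denotes the set of compact convex sets $K\subset\mathbb{R}^d$ with floor $F$ and ${\sf Vol}_d(K)=1$. For such $K$ and $n\geq 1$, $Q_K(n)$ denotes the probability that $n$ independent uniform random points $U_1,\dots,U_n$ in $K$ all lie on the boundary of ${\sf CH}(\{U_1,\dots,U_n\}\cup (F\times\{0\}))$. *)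

(* Defs.v *)
From mathcomp Require Import all_boot all_order all_algebra.
From mathcomp Require Import all_classical all_reals all_analysis.

Set Implicit Arguments.
Unset Strict Implicit.
Unset Printing Implicit Defensive.

Import Order.TTheory GRing.Theory Num.Theory.
Import numFieldNormedType.Exports.

Local Open Scope classical_set_scope.
Local Open Scope ring_scope.
Local Open Scope ereal_scope.

Section tuple_measure.
Context {d : measure_display} {T : measurableType d} {R : realType}.
Variable mu : set T -> \bar R.

(* n-fold product mu \x ... \x mu on n-tuples. Like [product_measure1], it
   makes sense for a bare set function; it is the usual product measure when
   mu is a sigma-finite measure. *)
Fixpoint tuple_measure (n : nat) : set (n.-tuple T) -> \bar R :=
  match n with
  | 0%N => fun A => \d_ ([tuple] : 0.-tuple T) A
  | k.+1 => fun A =>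
      (mu \x @tuple_measure k) [set p : T * k.-tuple T | A [tuple of p.1 :: p.2]]
  end.

End tuple_measure.

Section convex_sets.
Context {R : realType}.

(* R^n with its Borel sigma-algebra *)
Definition borel_rV (n : nat) := g_sigma_algebraType (@open 'rV[R]_n).

(* n-dimensional Lebesgue measure, transported from n-tuples to row vectors *)
Definition Vol (n : nat) (A : set 'rV[R]_n) : \bar R :=
  tuple_measure lebesgue_measure
    [set t : n.-tuple (measurableTypeR R) | A (\row_i (tnth t i : R))].

Definition convex_hull (n : nat) (A : set 'rV[R]_n) : set 'rV[R]_n :=
  smallest (fun B : set 'rV[R]_n => convex_set B) A.

Definition boundary (n : nat) (A : set 'rV[R]_n) : set 'rV[R]_n :=
  closure A `\` A°.

(* The ambient space is R^d with d = m.+1, and the last coordinate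
   x_d is x ord0 ord_max. *)

(* F * {0}: [col' ord_max x] is x without its last coordinate *)
Definition floor_set (m : nat) (F : set 'rV[R]_m) : set 'rV[R]_m.+1 :=
  [set x | F (col' ord_max x) /\ x ord0 ord_max = 0%R].

Definition has_floor (m : nat) (F : set 'rV[R]_m) (K : set 'rV[R]_m.+1) :=
  K `<=` [set x | (0 <= x ord0 ord_max)%R] /\
  K `&` [set x | x ord0 ord_max = 0%R] = floor_set F.

Definition CCSF (m : nat) (F : set 'rV[R]_m) : set (set 'rV[R]_m.+1) :=
  [set K : set 'rV[R]_m.+1 | [/\ compact K, convex_set K, has_floor F K & Vol K = 1]].

Definition unit_mountain (m : nat) (F : set 'rV[R]_m) (M : set 'rV[R]_m.+1) :=
  exists2 z : 'rV[R]_m.+1, z ord0 ord_max = (m.+1%:R)%R &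
    M = convex_hull (floor_set F `|` [set z]).

(* Law of a uniform random point of K *)
Definition uniform_law (n : nat) (K : set 'rV[R]_n) (B : set (borel_rV n)) :
  \bar R := Vol (B `&` K) * ((fine (Vol K))^-1)%:E.

(* Q_K(n), where F is the floor of K: the joint law of n independent uniform
   points of K is the n-fold product of their common law. *)
Definition Q (m : nat) (F : set 'rV[R]_m) (K : set 'rV[R]_m.+1) (n : nat) :
    \bar R :=
  tuple_measure (@uniform_law m.+1 K)
    [set U : n.-tuple (borel_rV m.+1) | forall i : 'I_n,
      boundary (convex_hull (range (tnth U) `|` floor_set F)) (tnth U i)].

End convex_sets.

(* Main.v *)
(** A random point [x] of [K] fails to be on the boundary of the hull of [x], [y]
    and the floor iff, up to a null set, it lies in the cone with apex [y] over
    the floor [F]. This cone has volume [y_d / d], so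
    [Q_K(2) = 1 - (2 / d) E(x_d)] for [x] uniform in [K], and everything reduces
    to the mean height of [K].

    The mean height is positive, and small for a flat frustum. It is maximal for
    mountains because the height of a uniform point of a mountain stochastically
    dominates that of [K]: if the slice of [K] at some height [t > r] is larger
    than the slice of the mountain, then by Brunn-Minkowski the same holds at all
    heights below [t], so [K] has more volume than the mountain below [r];
    otherwise it has less volume above [r].

    Brunn-Minkowski is obtained for compact convex sets in multiplicative form
    (Prekopa-Leindler), by induction on the dimension: slice volumes are
    quasi-concave, so only intervals occur on the line. *)

Require Import Defs.
From HB Require Import structures.
From mathcomp Require Import all_boot all_order all_algebra.
From mathcomp Require Import all_classical all_reals all_analysis.
From mathcomp Require Import measurable_realfun ring lra.

Set Implicit Arguments.
Unset Strict Implicit.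
Unset Printing Implicit Defensive.

Import Order.TTheory GRing.Theory Num.Theory.
Import numFieldNormedType.Exports.

Local Open Scope classical_set_scope.
Local Open Scope ring_scope.

(* [reals] exports another [floor_set]. *)
Local Notation floor_set := Defs.floor_set.

(** * Borel sets and volume on row vectors *)

(** The event in [Q] is not shown to be measurable; [tuple_measure] is an iterated integral that
    accepts any set. The event is therefore enclosed between two measurable ones. It is contained in
    the event that neither point is in the cone of the other over the interior of [F], and it
    contains the event that neither is in the cone of the other over [F], once points on the floor
    and pairs of equal height are discarded. The two have the same probability because a compact
    convex set of positive volume has the volume of its interior.

    The multiplicative form of Brunn-Minkowski is what survives the induction. Slice volumes are
    divided by their suprema, so that every level below 1 is reached and the Minkowski inequality
    for intervals applies level by level; the geometric mean of the suprema is then the right scale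
    for the third body. The additive form needed for slices is recovered by first rescaling the
    bodies to volume at least 1.

    Mountains and the flat bodies belong to one family, [frustum], whose slices have a linear size
    affine in the height, so that a single integral gives all their volumes. *)

Section insert.
Context {R : realType} {n : nat}.
Implicit Types (k : 'I_n.+1) (s t : R) (u v : 'rV[R]_n).

Definition ins k s v : 'rV[R]_n.+1 := \row_i oapp (v ord0) s (unlift k i).

Lemma ins_at k s v : ins k s v ord0 k = s.
Proof. by rewrite mxE unlift_none. Qed.

Lemma ins_lift k s v j : ins k s v ord0 (lift k j) = v ord0 j.
Proof. by rewrite mxE liftK. Qed.

Lemma col'_ins k s v : col' k (ins k s v) = v.
Proof. by apply/rowP => j; rewrite mxE ins_lift. Qed.

Lemma ins_col' k (x : 'rV[R]_n.+1) : ins k (x ord0 k) (col' k x) = x.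
Proof.
by apply/rowP => i; rewrite mxE; case: unliftP => [j|] ->//=; rewrite mxE.
Qed.

Lemma insD k s t u v : ins k s u + ins k t v = ins k (s + t) (u + v).
Proof. by apply/rowP => i; rewrite !mxE; case: unlift => [j|]//=; rewrite mxE. Qed.

Lemma insZ k (a : R) s u : a *: ins k s u = ins k (a * s) (a *: u).
Proof. by apply/rowP => i; rewrite !mxE; case: unlift => [j|]//=; rewrite mxE. Qed.

End insert.

Section borel_rV.
Context {R : realType}.

Lemma open_measurable_rV n (A : set 'rV[R]_n) : open A ->
  measurable (A : set (borel_rV (R := R) n)).
Proof. by move=> oA; exact: sub_sigma_algebra. Qed.

Lemma closed_measurable_rV n (A : set 'rV[R]_n) : closed A ->
  measurable (A : set (borel_rV (R := R) n)).
Proof.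
move=> cA; rewrite -[A]setCK; apply: measurableC.
by apply: open_measurable_rV; exact: closed_openC.
Qed.

Lemma compact_measurable_rV n (A : set 'rV[R]_n) : compact A ->
  measurable (A : set (borel_rV (R := R) n)).
Proof.
move=> cA; apply: closed_measurable_rV; exact: compact_closed.
Qed.

Lemma continuous_measurable_rV n (f : 'rV[R]_n -> R) : continuous f ->
  measurable_fun setT (f : borel_rV (R := R) n -> R).
Proof.
move=> /continuousP cf; apply: (measurability _ (measurable_realfun.RGenOpens.measurableE R)).
move=> _ [_ [a [b ->] <-]]; rewrite setTI; apply: open_measurable_rV.
exact/cf/interval_open.
Qed.

Lemma measurable_coord n (i : 'I_n) :
  measurable_fun setT (fun x : borel_rV (R := R) n => x ord0 i).
Proof. by apply: continuous_measurable_rV; exact: coord_continuous. Qed.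

(** An open set is a countable union of boxes [U p] with rational centre and radius [1 / k.+1], and
    the preimage of a box is a finite intersection of conditions on single coordinates. *)
Lemma measurable_fun_rV d (T : measurableType d) n (f : T -> borel_rV (R := R) n) :
  (forall i, measurable_fun setT (fun x => f x ord0 i)) -> measurable_fun setT f.
Proof.
move=> mf; apply: (@measurability _ _ T (borel_rV (R := R) n) setT f (@open 'rV[R]_n)) => //.
move=> _ [G oG <-]; rewrite setTI.
pose U (p : 'rV[rat]_n * nat) : set 'rV[R]_n :=
  [set y | forall i, `|ratr (p.1 ord0 i) - y ord0 i| < p.2.+1%:R^-1].
pose H (p : 'rV[rat]_n * nat) := [set x | U p `<=` G /\ U p (f x)].
have -> : f @^-1` G = \bigcup_p H p.
  apply/seteqP; split => [x Gx|x [p _ [UG Ux]]]; last exact: UG.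
  have /nbhs_ballP[e /= e0 eG] := oG _ Gx.
  (* Two errors below [1 / k.+1] add up on the way from [f x] to a point of the box, through its
     rational centre. *)
  have [k ke] : exists k, (k.+1%:R^-1 : R) < e / 2.
    have e20 : 0 < e / 2 by rewrite divr_gt0.
    have [k _ hk] := near_infty_natSinv_lt (PosNum e20).
    by exists k; exact: (hk k (leqnn k)).
  have q i : exists q : rat, `|ratr q - f x ord0 i| < k.+1%:R^-1.
    have k0 : 0 < k.+1%:R^-1 :> R by [].
    have [x' [ab [q _ qE]]] := @dense_rat R (ball (f x ord0 i) k.+1%:R^-1)
      (ex_intro _ _ (ballxx _ k0)) (ball_open _ _).
    by exists q; move: ab; rewrite -qE /ball/= distrC.
  have {}q i := cid (q i).
  exists (\row_i sval (q i), k) => //; split => [y Uy|i /=]; last first.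
    by rewrite mxE; exact: (svalP (q i)).
  apply: eG.
  split => // i j; rewrite ord1 /ball/=.
  have := svalP (q j); have := Uy j; rewrite /= mxE => h1 h2.
  rewrite (le_lt_trans (ler_distD (ratr (sval (q j))) _ _))// distrC.
  by rewrite (splitr e) ltrD// (lt_trans _ ke).
apply: countable_bigcupT_measurable => [|p]; first exact: countableP.
have [UG|UG] := pselect (U p `<=` G); last first.
  rewrite (_ : H p = set0); first exact: measurable0.
  by apply/seteqP; split => // x [].
have -> : H p = \bigcap_i [set x | `|ratr (p.1 ord0 i) - f x ord0 i| < p.2.+1%:R^-1].
  by apply/seteqP; split => [x [_ Ux] i _|x h]; [exact: Ux|split => // i; exact: h].
apply: fin_bigcap_measurable => // i _.
rewrite [X in measurable X](_ : _ =
    (fun x => `|ratr (p.1 ord0 i) - f x ord0 i|) @^-1` `]-oo, p.2.+1%:R^-1[);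
  last first.
  by apply/seteqP; split => x /=; rewrite in_itv.
rewrite -[X in measurable X]setTI.
have mh : measurable_fun setT (fun x => `|ratr (p.1 ord0 i) - f x ord0 i|).
  apply: measurableT_comp => //.
  exact: measurable_funB.
exact: mh.
Qed.

End borel_rV.

(** * Volume as a sigma-finite measure, and its slices *)

Section Vol_measure.
Context {R : realType}.
Local Open Scope ereal_scope.
Local Notation leb := (@lebesgue_measure R).
Local Notation borel n := (borel_rV (R := R) n).

Lemma measurable_ins n (k : 'I_n.+1) d (T : measurableType d)
    (f : T -> R) (g : T -> borel n) :
  measurable_fun setT f -> measurable_fun setT g ->
  measurable_fun setT (fun x => ins k (f x) (g x) : borel n.+1).
Proof.
move=> mf mg; apply: measurable_fun_rV => i.
case: (unliftP k i) => [j|] ->.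
  under eq_fun do rewrite ins_lift.
  exact: (measurableT_comp (measurable_coord j) mg).
by under eq_fun do rewrite ins_at.
Qed.

Lemma measurable_sect n (k : 'I_n.+1) (s : R) (A : set (borel n.+1)) :
  measurable A -> measurable ([set v | A (ins k s v)] : set (borel n)).
Proof.
move=> mA; rewrite -[X in measurable X]setTI.
have mi : measurable_fun setT (fun v : borel n => ins k s v : borel n.+1).
  apply: (@measurable_ins n k _ (borel n) (cst s) id).
    exact: measurable_cst.
  exact: measurable_id.
exact: (mi measurableT _ mA).
Qed.

Lemma VolS n (A : set 'rV[R]_n.+1) :
  Vol A = \int[leb]_s Vol [set v | A (ins ord0 s v)].
Proof.
rewrite [LHS]/Vol/= /product_measure1; apply: eq_integral => s _ /=.
rewrite /Vol; congr (tuple_measure _ _); apply/seteqP.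
suff e (t : n.-tuple R) :
    \row_i (tnth [tuple of s :: t] i : R) = ins ord0 s (\row_i (tnth t i : R)).
  by split => t /=; rewrite /xsection/= inE/= e.
apply/rowP => i; rewrite [LHS]mxE; case: (unliftP ord0 i) => [j|] ->.
  by rewrite ins_lift mxE; exact: tnthS.
by rewrite ins_at.
Qed.

Lemma Vol0 (A : set 'rV[R]_0) : Vol A = \d_((0%R : 'rV[R]_0) : borel 0) (A : set (borel 0)).
Proof.
rewrite /Vol/= /dirac /indic/=; congr (_ _)%:E; congr nat_of_bool.
by apply: asbool_equiv_eq => /=; rewrite [X in A X](_ : _ = 0%R)//; apply/rowP => -[].
Qed.

Definition consv n (p : R * borel n) : borel n.+1 := ins ord0 p.1 p.2.

Lemma measurable_consv n : measurable_fun setT (@consv n).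
Proof. by apply: measurable_ins; [exact: measurable_fst|exact: measurable_snd]. Qed.

Section cons_measure.
Variables (n : nat) (nu : {sigma_finite_measure set (borel n) -> \bar R}).

(** The product of Lebesgue measure with [nu], carried from pairs over to row vectors: the step by
    which [Vol] passes from one dimension to the next. *)
Definition cons_measure (A : set (borel n.+1)) : \bar R :=
  (leb \x nu) (@consv n @^-1` A).

Let cons_measure0 : cons_measure set0 = 0.
Proof. by rewrite /cons_measure preimage_set0 measure0. Qed.

Let cons_measure_ge0 A : 0 <= cons_measure A.
Proof. exact: measure_ge0. Qed.

Let cons_measure_sigma_additive : semi_sigma_additive cons_measure.
Proof.
have mc A : measurable A -> measurable (@consv n @^-1` A).
  by move=> mA; rewrite -[X in measurable X]setTI; exact: measurable_consv.
move=> F mF tF mUF; rewrite /cons_measure preimage_bigcup.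
apply: measure_semi_sigma_additive => [i||]; first exact: mc.
  apply/trivIsetP => /= i j _ _ ij; rewrite -preimage_setI.
  by move/trivIsetP : tF => /(_ _ _ _ _ ij) ->//; rewrite preimage_set0.
by rewrite -preimage_bigcup; exact: mc.
Qed.

HB.instance Definition _ := isMeasure.Build _ _ _
  cons_measure cons_measure0 cons_measure_ge0 cons_measure_sigma_additive.

Let cons_measure_sigma_finite : sigma_finite setT cons_measure.
Proof.
have /sigma_finiteP[G [GT ndG mG]] := sigma_finiteT leb.
have /sigma_finiteP[H [HT ndH mH]] := sigma_finiteT nu.
exists (fun k => [set x : borel n.+1 | G k (x ord0 ord0) /\ H k (col' ord0 x)]).
  apply/seteqP; split => // x _.
  have [i _ Gi] : (\bigcup_i G i) (x ord0 ord0) by rewrite -GT.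
  have [j _ Hj] : (\bigcup_j H j) (col' ord0 x) by rewrite -HT.
  exists (maxn i j) => //; split.
    by move: Gi; exact/subsetPset/ndG/leq_maxl.
  by move: Hj; exact/subsetPset/ndH/leq_maxr.
move=> i; have [mGi Gi] := mG i; have [mHi Hi] := mH i; split.
  rewrite (_ : mkset _ = (fun x : borel n.+1 => x ord0 ord0) @^-1` G i `&`
                         (fun x : borel n.+1 => col' ord0 x : borel n) @^-1` H i)//.
  apply: measurableI; rewrite -[X in measurable X]setTI.
    exact: (measurable_coord ord0 measurableT mGi).
  have mf : measurable_fun setT (fun x : borel n.+1 => col' ord0 x : borel n).
    apply: measurable_fun_rV => k; under eq_fun do rewrite mxE.
    exact: measurable_coord.
  exact: (mf measurableT _ mHi).
rewrite /cons_measure [X in _ X < _](_ : _ = G i `*` H i).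
  by rewrite product_measure1E// lte_mul_pinfty// ge0_fin_numE.
by apply/seteqP; split => -[s v]; rewrite /= ins_at col'_ins.
Qed.

HB.instance Definition _ := Measure_isSigmaFinite.Build _ _ _
  cons_measure cons_measure_sigma_finite.

End cons_measure.

(** The induction carries a bundled measure, since the product in the next dimension needs a
    sigma-finite second factor. *)
Lemma exists_Vol_measure n :
  exists nu : {sigma_finite_measure set (borel n) -> \bar R},
    (nu : set _ -> \bar R) = @Vol R n.
Proof.
elim: n => [|n [nu nuE]].
  exists (\d_((0%R : 'rV[R]_0) : borel 0)).
  by apply/funext => A; rewrite Vol0.
exists (cons_measure nu); apply/funext => A.
rewrite VolS /= /cons_measure /product_measure1; apply: eq_integral => s _ /=.
rewrite nuE; congr Vol; apply/seteqP.
by split => v; rewrite /xsection/= inE.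
Qed.

(** A copy of [Vol] on the Borel space, to which the measure structure is attached so that it can be
    inferred. *)
Definition vol n : set (borel n) -> \bar R := @Vol R n.

Let vol_set0 n : @vol n set0 = 0.
Proof. by rewrite /vol; have [nu <-] := exists_Vol_measure n; exact: measure0. Qed.

Let vol_ge0 n A : 0 <= @vol n A.
Proof. by rewrite /vol; have [nu <-] := exists_Vol_measure n; exact: measure_ge0. Qed.

Let vol_sigma_additive n : semi_sigma_additive (@vol n).
Proof.
rewrite /vol; have [nu <-] := exists_Vol_measure n.
exact: measure_semi_sigma_additive.
Qed.

HB.instance Definition _ n := isMeasure.Build _ _ _ (@vol n)
  (@vol_set0 n) (@vol_ge0 n) (@vol_sigma_additive n).

Let vol_sigma_finite n : sigma_finite setT (@vol n).
Proof.
rewrite /vol; have [nu <-] := exists_Vol_measure n.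
exact: sigma_finiteT.
Qed.

HB.instance Definition _ n := Measure_isSigmaFinite.Build _ _ _
  (@vol n) (@vol_sigma_finite n).

Lemma measurable_fun_vol_sect n (k : 'I_n.+1) (A : set 'rV[R]_n.+1) :
  measurable (A : set (borel n.+1)) ->
  measurable_fun setT (fun s : R => Vol [set v | A (ins k s v)]).
Proof.
move=> mA.
have mi : measurable_fun setT (fun p : R * borel n => ins k p.1 p.2 : borel n.+1).
  by apply: measurable_ins; [exact: measurable_fst|exact: measurable_snd].
have := @measurable_fun_xsection _ _ R (borel n) R (@vol n)
  ((fun p : R * borel n => ins k p.1 p.2 : borel n.+1) @^-1` A).
rewrite -[X in measurable X]setTI => /(_ (mi measurableT _ mA)).
congr measurable_fun; apply/funext => s /=; rewrite /vol; congr Vol.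
by apply/seteqP; split => v; rewrite /xsection/= inE.
Qed.

(* Tonelli: the slices defining [Vol] are orthogonal to the first axis, those
   of a set over its floor to the last one. *)
Lemma Vol_last n (A : set 'rV[R]_n.+1) : measurable (A : set (borel n.+1)) ->
  Vol A = \int[leb]_s Vol [set v | A (ins ord_max s v)].
Proof.
elim: n A => [|n IH] A mA.
  by rewrite VolS (ord1 ord_max).
rewrite VolS.
have swapE s t v : ins (n := n.+1) ord0 s (ins ord_max t v) =
                   ins ord_max t (ins ord0 s v).
  apply/rowP => i; case: (unliftP ord0 i) => [j|] ->.
    rewrite ins_lift; case: (unliftP ord_max j) => [k|] ->.
      rewrite ins_lift (_ : lift ord0 (lift ord_max k) = lift ord_max (lift ord0 k)).
        by rewrite !ins_lift.
      by apply/val_inj; rewrite /= /bump !leq0n /= !add1n ltnS leqNgt ltn_ord.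
    rewrite ins_at (_ : lift ord0 ord_max = ord_max) ?ins_at//.
    exact/val_inj.
  rewrite ins_at (_ : ord0 = lift ord_max ord0 :> 'I_n.+2) ?ins_lift ?ins_at//.
  exact/val_inj.
(* The volume left once the first and the last coordinate are both fixed; the induction hypothesis
   brings out the last one inside each first slice, and Tonelli exchanges the two. *)
pose g (p : R * R) := Vol [set v | A (ins ord0 p.1 (ins ord_max p.2 v))].
have mg : measurable_fun setT g.
  have mi : measurable_fun setT (fun p : (R * R) * borel n =>
     ins (n := n.+1) ord0 p.1.1 (ins ord_max p.1.2 p.2) : borel n.+2).
    apply: measurable_ins; first exact: measurableT_comp.
    apply: measurable_ins; first exact: measurableT_comp.
    exact: measurable_snd.
  have := @measurable_fun_xsection _ _ (R * R)%type (borel n) R (@vol n) _ (mi measurableT _ mA).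
  congr measurable_fun; apply/funext => s /=; rewrite /vol /g; congr Vol.
  by apply/seteqP; split => v; rewrite /xsection/= inE // => -[].
transitivity (\int[leb]_s \int[leb]_t g (s, t)).
  by apply: eq_integral => s _; rewrite IH//; exact: measurable_sect.
rewrite (@fubini_tonelli _ _ _ _ R leb leb g) => //; last first.
  by move=> p; rewrite /g -/(vol _); exact: measure_ge0.
apply: eq_integral => t _; rewrite VolS; apply: eq_integral => s _.
by rewrite /g; congr Vol; apply/seteqP; split => v /=; rewrite swapE.
Qed.

End Vol_measure.

(** * The Prekopa-Leindler inequality on the line *)

Section affine.
Context {R : realType}.
Local Open Scope ereal_scope.
Local Notation leb := (@lebesgue_measure R).
Local Notation borel n := (borel_rV (R := R) n).

(** By uniqueness of Lebesgue measure: [c] times its image under [s |-> c^-1 * (s - b)] gives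
    half-open intervals their length. *)
Lemma integral_affine (f : R -> \bar R) (b c : R) : (0 < c)%R ->
  measurable_fun setT f -> (forall x, 0 <= f x) ->
  \int[leb]_s f (c^-1 * (s - b))%R = c%:E * \int[leb]_s f s.
Proof.
move=> c0 mf f0.
have c1 : (0 <= c^-1)%R by rewrite invr_ge0 ltW.
pose phi (s : measurableTypeR R) : measurableTypeR R := (c^-1 * (s - b))%R.
have mphi : measurable_fun setT phi.
  by apply: measurable_funM => //; exact: measurable_funB.
pose mu : {measure set (measurableTypeR R) -> \bar R} :=
  mscale (NngNum c1) (measure_function_pushforward__canonical__measure_function_Measure leb mphi).
have lebE A : measurable A -> leb A = mu A.
  apply: lebesgue_measure_unique => _ [[x y] /= xy <-].
  rewrite /mu/= /mscale /pushforward/=.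
  rewrite [X in _ * leb X](_ : _ = [set` `](c * x + b), (c * y + b)]])%R.
    rewrite !lebesgue_measure_itv/= !lte_fin ltrD2r ltr_pM2l//.
    case: ifPn => _; last by rewrite mule0.
    by rewrite -!EFinD -EFinM; congr (_%:E); field; rewrite gt_eqF.
  apply/seteqP; split => s /=; rewrite !in_itv/= /phi => /andP[h1 h2]; apply/andP; split.
  - by move: h1; rewrite mulrC ltr_pdivlMr// ltrBrDr mulrC.
  - by move: h2; rewrite mulrC ler_pdivrMr// lerBlDr mulrC.
  - by rewrite mulrC ltr_pdivlMr// ltrBrDr mulrC.
  - by rewrite mulrC ler_pdivrMr// lerBlDr mulrC.
rewrite [in RHS](@eq_measure_integral _ _ _ setT mu); last by move=> A mA _; exact: lebE.
rewrite ge0_integral_mscale//= ge0_integral_pushforward//.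
by rewrite muleA -EFinM divff ?gt_eqF// mul1e.
Qed.

Lemma Vol_affine n (A : set 'rV[R]_n) (b : 'rV[R]_n) (c : R) :
  (0 < c)%R -> measurable (A : set (borel n)) ->
  Vol [set x | A (c^-1 *: (x - b))] = (c ^+ n)%:E * Vol A.
Proof.
move=> c0; elim: n A b => [|n IH] A b mA.
  rewrite expr0 mul1e; congr Vol; apply/seteqP.
  have e (x y : 'rV[R]_0) : x = y by apply/rowP => -[].
  by split => x /=; rewrite (e (_ *: _) x).
have e s v : c^-1 *: (ins ord0 s v - b) =
             ins ord0 (c^-1 * (s - b ord0 ord0)) (c^-1 *: (v - col' ord0 b)).
  by rewrite -{1}(ins_col' ord0 b) -scaleN1r insZ insD insZ mulN1r scaleN1r.
rewrite !VolS exprS EFinM -muleA -ge0_integralZl//=; first last.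
- by rewrite lee_fin exprn_ge0// ltW.
- by move=> s _; rewrite -/(vol _); exact: measure_ge0.
- exact: measurable_fun_vol_sect.
rewrite -(@integral_affine
    (fun s => (c ^+ n)%:E * Vol [set v | A (ins ord0 s v)]) (b ord0 ord0))//.
- apply: eq_integral => s _.
  rewrite -(IH _ (col' ord0 b)); last exact: measurable_sect.
  by congr Vol; apply/seteqP; split => v /=; rewrite e.
- by apply: measurable_funeM; exact: measurable_fun_vol_sect.
- move=> s; rewrite mule_ge0//; first by rewrite lee_fin exprn_ge0// ltW.
  by rewrite -/(vol _); exact: measure_ge0.
Qed.

End affine.

Section prekopa_leindler_line.
Context {R : realType}.
Local Open Scope ereal_scope.
Local Notation leb := (@lebesgue_measure R).

(** Otherwise [I] would lie in [[inf I, inf I + r]]. This trades an interval with unknown endpoints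
    for a compact segment of almost the same length. *)
Lemma lebesgue_chord (I : set R) (r : R) : I !=set0 -> is_interval I ->
  r%:E < leb I -> exists a b, [/\ I a, I b, (a <= b)%R & (r <= b - a)%R].
Proof.
move=> [x0 Ix0] itvI rI.
have [r0|r0] := leP r 0%R; first by exists x0, x0; split; rewrite ?subrr.
apply: contrapT => H.
have Hlt a b : I a -> I b -> (b - a < r)%R.
  move=> Ia Ib; rewrite ltNge; apply/negP => rab; apply: H; exists a, b; split => //.
  by rewrite -subr_ge0 (le_trans _ rab)// ltW.
have lbI : lbound I (x0 - r)%R.
  by move=> y Iy; rewrite lerBlDr -lerBlDl ltW// Hlt.
have hi : has_inf I by split; [exists x0|exists (x0 - r)%R].
suff : leb I <= r%:E by rewrite leNgt rI.
apply: (@le_trans _ _ (leb `[inf I, inf I + r]%classic)%R).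
  apply: le_measure; rewrite ?inE//; first exact: is_interval_measurable.
  move=> y Iy /=; rewrite in_itv/=; apply/andP; split; first exact: (ge_inf hi.2).
  rewrite -lerBlDr; apply: lb_le_inf => [|z Iz]; first by exists x0.
  by rewrite lerBlDr -lerBlDl ltW// Hlt.
by rewrite lebesgue_measure_itv/= lte_fin ltrDl r0 -EFinD addrAC subrr add0r.
Qed.

(** Up to [e], both intervals are replaced by segments between two of their points; the combinations
    of these segments fill a segment inside [W] whose length is the weighted mean of theirs. *)
Lemma lebesgue_minkowski (I J W : set R) (l : R) : (0 < l < 1)%R ->
  I !=set0 -> J !=set0 -> is_interval I -> is_interval J -> measurable W ->
  leb I < +oo -> leb J < +oo ->
  (forall s t, I s -> J t -> W ((1 - l) * s + l * t)%R) ->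
  (1 - l)%:E * leb I + l%:E * leb J <= leb W.
Proof.
move=> /andP[l0 l1] I0 J0 iI iJ mW Ioo Joo IJW.
have l1' : (0 < 1 - l)%R by rewrite subr_gt0.
have fI : leb I \is a fin_num by rewrite ge0_fin_numE.
have fJ : leb J \is a fin_num by rewrite ge0_fin_numE.
apply/lee_addgt0Pr => e e0.
have [a [b [Ia Ib ab rI]]] : exists a b,
    [/\ I a, I b, (a <= b)%R & (fine (leb I) - e <= b - a)%R].
  by apply: lebesgue_chord => //; rewrite -[ltRHS]fineK// lte_fin ltrBlDr ltrDl.
have [c [d [Jc Jd cd rJ]]] : exists a b,
    [/\ J a, J b, (a <= b)%R & (fine (leb J) - e <= b - a)%R].
  by apply: lebesgue_chord => //; rewrite -[ltRHS]fineK// lte_fin ltrBlDr ltrDl.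
pose u := ((1 - l) * a + l * c)%R; pose v := ((1 - l) * b + l * d)%R.
have uv : (u <= v)%R by rewrite lerD// ler_pM2l.
have sub : `[u, v]%classic `<=` W.
  move=> y /=; rewrite in_itv/= => /andP[uy yv].
  have [uv'|uv'] := eqVneq u v.
    have -> : y = u by apply/eqP; rewrite eq_le uy uv' yv.
    exact: IJW.
  have vu : (0 < v - u)%R by rewrite subr_gt0 lt_neqAle uv'.
  (* The relative position of [y] in [[u, v]]; the points at the same relative position in the two
     segments combine to [y]. *)
  pose m := ((y - u) / (v - u))%R.
  have m0 : (0 <= m)%R by rewrite divr_ge0 ?subr_ge0// ltW.
  have m1 : (m <= 1)%R by rewrite ler_pdivrMr// mul1r lerD2r.
  have seg (K : set R) p q : is_interval K -> (p <= q)%R -> K p -> K q ->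
      K (p + m * (q - p))%R.
    move=> iK pq Kp Kq; apply: (iK p q) => //.
    rewrite lerDl mulr_ge0 ?subr_ge0//= -lerBrDl ler_piMl// subr_ge0//.
  have -> : y = ((1 - l) * (a + m * (b - a)) + l * (c + m * (d - c)))%R.
    have -> : y = (u + m * (v - u))%R.
      by rewrite /m divfK ?gt_eqF// addrCA subrr addr0.
    by rewrite /u /v; ring.
  by apply: IJW; exact: seg.
apply: (@le_trans _ _ (leb `[u, v]%classic + e%:E)); last first.
  by rewrite leeD2r// le_measure// inE.
rewrite lebesgue_measure_itv/= lte_fin.
have -> : (if (u < v)%R then v%:E - u%:E else 0) = (v - u)%:E.
  by case: ltgtP uv => // -> _; rewrite subrr.
rewrite -[leb I]fineK// -[leb J]fineK// -!EFinM -!EFinD lee_fin.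
have h1 := ler_wpM2l (ltW l1') rI.
have h2 := ler_wpM2l (ltW l0) rJ.
rewrite /u /v.
by nra.
Qed.

(** Tonelli for the region under the graph of [f], cut off at height 1 because only levels below 1
    are compared later. *)
Lemma layer_cake (f : R -> R) : measurable_fun setT f -> (forall x, 0 <= f x)%R ->
  \int[leb]_(t in `]0%R, 1%R[) leb [set s | (t <= f s)%R] =
  \int[leb]_s (Num.min (f s) 1)%:E.
Proof.
move=> mf f0.
pose D := [set p : R * R | (0 < p.1 < 1)%R && (p.1 <= f p.2)%R].
have mD : measurable D.
  rewrite (_ : D =
      (fun p => (0 < p.1)%R && (p.1 < 1)%R && (p.1 <= f p.2)%R) @^-1` [set true]); last first.
    by apply/seteqP; split => p.
  have m1 : measurable_fun setT (fun p : R * R =>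
      (0 < p.1)%R && (p.1 < 1)%R && (p.1 <= f p.2)%R).
    apply: measurable_and; first apply: measurable_and.
    - exact: measurable_fun_ltr.
    - exact: measurable_fun_ltr.
    - by apply: measurable_fun_ler => //; exact: measurableT_comp.
  by rewrite -[X in measurable X]setTI; exact: m1.
have mi : measurable_fun setT (fun p => (\1_D p)%:E : \bar R).
  by apply/measurable_EFinP; exact: measurable_indic.
transitivity (\int[leb]_t \int[leb]_s (\1_D (t, s))%:E).
  rewrite integral_mkcond; apply: eq_integral => t _; rewrite patchE.
  have -> : (fun s => (\1_D (t, s))%:E : \bar R) =
      (fun s => (\1_(xsection D t) s)%:E).
    apply/funext => s; rewrite !indicE; congr ((nat_of_bool _)%:R%:E);
    by apply/idP/idP => /set_mem h; apply/mem_set; move: h; rewrite /xsection/= inE.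
  rewrite integral_indic// ?setIT; last exact: measurable_xsection.
  case: ifPn => [/set_mem/=|]; last move=> /negP tn.
    rewrite in_itv/= => t01; congr (leb _).
    by apply/seteqP; split => s; rewrite /xsection/= inE /D/= t01.
  have t01 : (0 < t < 1)%R = false.
    by apply/negbTE/negP => h; apply: tn; rewrite inE/= in_itv.
  rewrite (_ : xsection D t = set0) ?measure0//.
  by apply/seteqP; split => s //; rewrite /xsection/= inE /D/= t01.
rewrite (@fubini_tonelli _ _ _ _ R leb leb (fun p => (\1_D p)%:E))//.
apply: eq_integral => s _.
have -> : (fun t => (\1_D (t, s))%:E : \bar R) = (fun t => (\1_(ysection D s) t)%:E).
  apply/funext => t; rewrite !indicE; congr ((nat_of_bool _)%:R%:E);
    by apply/idP/idP => /set_mem h; apply/mem_set; move: h; rewrite /ysection/= inE.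
rewrite integral_indic// ?setIT; last exact: measurable_ysection.
have [fs1|fs1] := leP 1%R (f s).
  rewrite (_ : ysection D s = `]0%R, 1%R[%classic).
    by rewrite /= lebesgue_measure_itv/= lte_fin ltr01 oppr0 adde0.
  apply/seteqP; split => t; rewrite /ysection/= inE /D/= in_itv/=; first by case/andP.
  by move=> /[dup] t01 ->/=; case/andP: t01 => _ /ltW/le_trans; apply.
rewrite (_ : ysection D s = `]0%R, f s]%classic).
  rewrite /= lebesgue_measure_itv/= lte_fin oppr0 adde0.
  by have := f0 s; rewrite le_eqVlt => /predU1P[<-|->]; rewrite ?ltxx.
apply/seteqP; split => t; rewrite /ysection/= inE /D/= in_itv/=.
  by case/andP => /andP[-> _] ->.
by case/andP => -> h; rewrite h (le_lt_trans h).
Qed.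

(** Since [f] and [g] reach every level below 1, their level sets are nonempty intervals there and
    the Minkowski inequality on the line holds at each level; integrating over the levels gives an
    arithmetic mean, stronger than the usual geometric one. *)
Lemma prekopa_leindler_line (f g h : R -> R) (l : R) : (0 < l < 1)%R ->
  measurable_fun setT f -> measurable_fun setT g -> measurable_fun setT h ->
  (forall x, 0 <= f x <= 1)%R -> (forall x, 0 <= g x <= 1)%R ->
  (forall x, 0 <= h x)%R ->
  (forall t : R, 0 < t < 1 -> exists s, t <= f s)%R ->
  (forall t : R, 0 < t < 1 -> exists s, t <= g s)%R ->
  (forall t : R, 0 < t < 1 -> is_interval [set s | t <= f s])%R ->
  (forall t : R, 0 < t < 1 -> is_interval [set s | t <= g s])%R ->
  (forall t : R, (0 < t < 1)%R -> leb [set s | (t <= f s)%R] < +oo) ->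
  (forall t : R, (0 < t < 1)%R -> leb [set s | (t <= g s)%R] < +oo) ->
  (forall t s1 s2 : R, 0 < t < 1 -> t <= f s1 -> t <= g s2 ->
     t <= h ((1 - l) * s1 + l * s2))%R ->
  (1 - l)%:E * \int[leb]_s (f s)%:E + l%:E * \int[leb]_s (g s)%:E <=
  \int[leb]_s (h s)%:E.
Proof.
move=> l01 mf mg mh f01 g01 h0 nf ng If Ig ff fg fgh.
have [l0 l1] := andP l01.
have minE (k : R -> R) : (forall x, 0 <= k x <= 1)%R ->
    \int[leb]_s (Num.min (k s) 1)%:E = \int[leb]_s (k s)%:E.
  by move=> k01; apply: eq_integral => s _; rewrite min_l//; case/andP: (k01 s).
have mlevel (k : R -> R) : measurable_fun setT k ->
    measurable_fun setT (fun t : R => leb [set s | (t <= k s)%R]).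
  move=> mk; pose D := [set p : R * R | (p.1 <= k p.2)%R].
  have mD : measurable D.
    have m1 : measurable_fun setT (fun p : R * R => p.1 <= k p.2)%R.
      by apply: measurable_fun_ler => //; exact: measurableT_comp.
    by have := m1 measurableT [set true]; rewrite setTI; exact.
  have := measurable_fun_xsection leb mD.
  congr measurable_fun; apply/funext => t /=; congr (leb _).
  by apply/seteqP; split => s; rewrite /xsection/= inE.
have hle : \int[leb]_s (Num.min (h s) 1)%:E <= \int[leb]_s (h s)%:E.
  apply: ge0_le_integral => //.
  - by move=> s _; rewrite lee_fin le_min h0 ler01.
  - by apply/measurable_EFinP; exact: measurable_minr.
  - exact/measurable_EFinP.
  - by move=> s _; rewrite lee_fin ge_min lexx.
apply: le_trans hle.
rewrite -(minE f)// -(minE g)// -!layer_cake//; last 2 first.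
- by move=> x; case/andP: (g01 x).
- by move=> x; case/andP: (f01 x).
rewrite -!ge0_integralZl//; try by
  [apply: measurable_funTS; exact: mlevel|rewrite lee_fin subr_ge0 ltW|rewrite lee_fin ltW].
rewrite -ge0_integralD//; last 4 first.
- by move=> t _; rewrite mule_ge0// lee_fin subr_ge0 ltW.
- by apply: measurable_funTS; apply: measurable_funeM; exact: mlevel.
- by move=> t _; rewrite mule_ge0// lee_fin ltW.
- by apply: measurable_funTS; apply: measurable_funeM; exact: mlevel.
apply: ge0_le_integral => //.
- move=> t _; rewrite adde_ge0//; first by rewrite mule_ge0// lee_fin subr_ge0 ltW.
  by rewrite mule_ge0// lee_fin ltW.
- apply: emeasurable_funD; apply: measurable_funTS; apply: measurable_funeM; exact: mlevel.
- by apply: measurable_funTS; exact: mlevel.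
move=> t /=; rewrite in_itv/= => t01; apply: lebesgue_minkowski => //.
- by have [s] := nf _ t01; exists s.
- by have [s] := ng _ t01; exists s.
- exact: If.
- exact: Ig.
- have m1 : measurable_fun setT (fun s => t <= h s)%R by exact: measurable_fun_ler.
  by have := m1 measurableT [set true]; rewrite setTI; exact.
- exact: ff.
- exact: fg.
- by move=> s1 s2; exact: fgh.
Qed.

End prekopa_leindler_line.

(** * The Brunn-Minkowski inequality *)

Section convexity.
Context {R : realType}.

Lemma convex_setP n (A : set 'rV[R]_n) : convex_set A <->
  forall x y t, 0 <= t <= 1 -> A x -> A y -> A ((1 - t) *: x + t *: y).
Proof.
split => [cA x y t /andP[t0 t1] Ax Ay|cA x y t].
  have := cA y x (Itv01 t0 t1) (mem_set Ay) (mem_set Ax).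
  by rewrite inE addrC.
rewrite !inE => Ax Ay; have := cA y x t%:num _ Ay Ax; rewrite addrC.
by apply; rewrite ge0 le1.
Qed.

Lemma convex_sect n (k : 'I_n.+1) (s : R) (A : set 'rV[R]_n.+1) :
  convex_set A -> convex_set [set v | A (ins k s v)].
Proof.
move=> /convex_setP cA; apply/convex_setP => x y t t01 /= Ax Ay.
by have := cA _ _ _ t01 Ax Ay; rewrite !insZ insD -mulrDl subrK mul1r.
Qed.

End convexity.

(** * Compact sets: slices, bounds and finite volume *)

Section compactness.
Context {R : realType}.
Local Notation borel n := (borel_rV (R := R) n).

Lemma continuous_rV_at (T : topologicalType) n (f : T -> 'rV[R]_n) (x : T) :
  (forall i, {for x, continuous (fun x => f x ord0 i)}) -> {for x, continuous f}.
Proof.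
move=> cf A [P Px PA].
have : \forall y \near x, forall i j, P i j (f y i j).
  apply: filter_forall => i; apply: filter_forall => j.
  by rewrite (ord1 i); apply: cf; exact: (Px ord0 j).
by apply: filterS => y /PA.
Qed.

Lemma continuous_rV (T : topologicalType) n (f : T -> 'rV[R]_n) :
  (forall i, continuous (fun x => f x ord0 i)) -> continuous f.
Proof. by move=> cf x; apply: continuous_rV_at => i; exact: cf. Qed.

Lemma continuous_ins n (k : 'I_n.+1) (T : topologicalType) (f : T -> R)
    (g : T -> 'rV[R]_n) : continuous f -> continuous g ->
  continuous (fun x => ins k (f x) (g x)).
Proof.
move=> cf cg; apply: continuous_rV => i.
case: (unliftP k i) => [j|] ->.
  under eq_fun do rewrite ins_lift.
  move=> x; apply: (@continuous_comp _ _ _ g (fun v => v ord0 j)); first exact: cg.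
  exact: coord_continuous.
by under eq_fun do rewrite ins_at.
Qed.

Lemma coord_le_norm n (x : 'rV[R]_n) i : `|x ord0 i| <= `|x|.
Proof.
rewrite [leRHS]/Num.Def.normr /= mx_normrE.
exact: (le_bigmax _ (fun ij => `|x ij.1 ij.2|) (ord0, i)).
Qed.

Lemma compact_coord_bounded n (A : set 'rV[R]_n) : compact A ->
  exists2 M, 0 < M & forall x i, A x -> `|x ord0 i| <= M.
Proof.
move=> /compact_bounded[M [Mr AM]]; exists (Num.max M 0 + 1).
  by rewrite ltr_wpDl// le_max lexx orbT.
move=> x i Ax; apply: (le_trans (coord_le_norm x i)); apply: AM Ax.
by rewrite (@le_lt_trans _ _ (Num.max M 0)) ?ltrDl// le_max lexx.
Qed.

Lemma compact_sect n (k : 'I_n.+1) (s : R) (A : set 'rV[R]_n.+1) :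
  compact A -> compact [set v | A (ins k s v)].
Proof.
move=> cA; apply: bounded_closed_compact; last first.
  apply: (@closed_comp _ _ (fun v => ins k s v) A); last exact: compact_closed.
  have ci : continuous (fun v : 'rV[R]_n => ins k s v).
    exact: (@continuous_ins n k _ (fun=> s) idfun (fun u => @cvg_cst _ s _ (nbhs u) _)
                                                  (fun u => @cvg_id _ (nbhs u))).
  by move=> v _; exact: ci.
have [M M0 AM] := compact_coord_bounded cA.
exists M; split; first exact: num_real.
move=> N MN v Av /=; rewrite [leLHS]/Num.Def.normr /= mx_normrE; apply/bigmax_leP.
split=> [|[i j] _ /=]; first by rewrite (le_trans (ltW M0))// ltW.
rewrite ord1 -(ins_lift k s) (le_trans _ (ltW MN))//; exact: AM.
Qed.

Local Open Scope ereal_scope.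

Lemma Vol_le n (A B : set 'rV[R]_n) : measurable (A : set (borel n)) ->
  measurable (B : set (borel n)) -> A `<=` B -> Vol A <= Vol B.
Proof.
by move=> mA mB AB; rewrite -!/(vol _) le_measure// inE.
Qed.

Lemma Vol_ge0 n (A : set 'rV[R]_n) : 0 <= Vol A.
Proof. by rewrite -/(vol _); exact: measure_ge0. Qed.

Lemma Vol_set0 n : Vol (set0 : set 'rV[R]_n) = 0.
Proof. by rewrite -/(vol _); exact: measure0. Qed.

Lemma Vol_bounded n (A : set 'rV[R]_n) (M : R) : (0 <= M)%R ->
  measurable (A : set (borel n)) -> (forall x i, A x -> `|x ord0 i| <= M)%R ->
  Vol A <= ((M *+ 2) ^+ n)%:E.
Proof.
move=> M0; elim: n A => [|n IH] A mA AM.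
  by rewrite Vol0 /dirac indicE expr0 lee_fin lern1 leq_b1.
rewrite VolS.
apply: (@le_trans _ _ (\int[lebesgue_measure]_(s in `[(- M)%R, M]) ((M *+ 2) ^+ n)%:E)).
  rewrite [leRHS]integral_mkcond; apply: ge0_le_integral => //.
  - by move=> s _; exact: Vol_ge0.
  - exact: measurable_fun_vol_sect.
  - by apply/(measurable_restrictT _ _).1 => //; exact: measurable_cst.
  move=> s _; rewrite patchE; case: ifPn => sM.
    apply: IH; first exact: measurable_sect.
    by move=> x i Ax; rewrite -(ins_lift ord0 s); exact: AM.
  rewrite (_ : mkset _ = set0) ?Vol_set0//.
  apply/seteqP; split => // v /= /(AM _ ord0); rewrite ins_at => h.
  by move: sM; rewrite notin_setE/= in_itv/= -ler_norml.
rewrite integral_cst//= lebesgue_measure_itv/= lte_fin.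
rewrite exprSr EFinM; apply: lee_wpmul2l; first by rewrite lee_fin exprn_ge0// mulrn_wge0.
case: ifPn => _; last by rewrite lee_fin mulrn_wge0.
by rewrite -EFinB opprK mulr2n.
Qed.

Lemma Vol_compact_fin n (A : set 'rV[R]_n) : compact A -> Vol A \is a fin_num.
Proof.
move=> cA; rewrite ge0_fin_numE ?Vol_ge0//.
have [M M0 AM] := compact_coord_bounded cA.
rewrite (le_lt_trans (Vol_bounded (ltW M0) _ AM)) ?ltry//.
exact: compact_measurable_rV.
Qed.

End compactness.

Section prekopa_leindler.
Context {R : realType}.
Local Notation leb := (@lebesgue_measure R).
Local Notation borel n := (borel_rV (R := R) n).

Lemma fin_num_mulel (d : R) (k v : \bar R) : 0 < d -> v \is a fin_num ->
  v = (d%:E * k)%E -> k \is a fin_num /\ fine k = fine v / d.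
Proof.
move=> d0 fv vE; move: fv; rewrite {}vE; case: k => [r _||].
- by split => //=; rewrite mulrC mulKf// gt_eqF.
- by rewrite gt0_muley.
- by rewrite gt0_muleNy.
Qed.

Lemma powR_prod_conv (a l : R) : 0 < a -> a `^ (1 - l) * a `^ l = a.
Proof. by move=> a0; rewrite -powRD ?subrK ?powRr1 ?ltW// gt_eqF ?implybT. Qed.

(** Young's inequality with the conjugate exponents [1 / (1 - l)] and [1 / l]. *)
Lemma powR_mean_le (x y l : R) : 0 < l < 1 -> 0 < x -> 0 < y ->
  x `^ (1 - l) * y `^ l <= (1 - l) * x + l * y.
Proof.
move=> /andP[l0 l1] x0 y0.
have l1' : 0 < 1 - l by rewrite subr_gt0.
have := @conjugate_powR R (x `^ (1 - l)) (y `^ l) (1 - l)^-1 l^-1.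
rewrite !invrK subrK !powR_ge0 !invr_gt0 l0 l1' => /(_ isT isT isT isT erefl).
by rewrite -!powRrM !divff ?gt_eqF// !powRr1 ?(ltW x0) ?(ltW y0)// [x * _]mulrC [y * _]mulrC.
Qed.

(** The volumes enter through positive real lower bounds [a] and [b], since [powR] acts on reals and
    level sets of slice volumes only provide inequalities. For the same reason [C] is any compact
    set containing the combinations: a slice of a Minkowski sum can be larger than the combination
    of two given slices. *)
Definition brunn_minkowski_dim n := forall (A B C : set 'rV[R]_n) (l a b : R),
  0 < l < 1 -> compact A -> compact B -> compact C ->
  convex_set A -> convex_set B ->
  (forall x y, A x -> B y -> C ((1 - l) *: x + l *: y)) ->
  0 < a -> 0 < b -> (a%:E <= Vol A)%E -> (b%:E <= Vol B)%E ->
  ((a `^ (1 - l) * b `^ l)%:E <= Vol C)%E.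

Lemma measurable_fine_sect n (A : set 'rV[R]_n.+1) : compact A ->
  measurable_fun setT (fun s : R => fine (Vol [set v | A (ins ord0 s v)])).
Proof.
move=> cA; apply/measurable_EFinP.
rewrite (_ : _ \o _ = fun s : R => Vol [set v | A (ins ord0 s v)]).
  by apply: measurable_fun_vol_sect; exact: compact_measurable_rV.
by apply/funext => s /=; rewrite fineK//; apply: Vol_compact_fin; exact: compact_sect.
Qed.

(* The slice volumes of [A], normalized to have supremum 1. *)
Lemma sect_profile n (A : set 'rV[R]_n.+1) : brunn_minkowski_dim n ->
  compact A -> convex_set A -> (0 < Vol A)%E ->
  exists (al : R) (f : R -> R), [/\ 0 < al,
    forall s, Vol [set v | A (ins ord0 s v)] = (al * f s)%:E,
    measurable_fun setT f,
    Vol A = (al%:E * \int[leb]_s (f s)%:E)%E &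
    [/\ forall x, 0 <= f x <= 1,
    forall t : R, 0 < t < 1 -> exists s, t <= f s,
    forall t : R, 0 < t < 1 -> is_interval [set s | t <= f s] &
    forall t : R, 0 < t < 1 -> (leb [set s | (t <= f s)%R] < +oo)%E]].
Proof.
move=> BM cA vA A0.
pose a s := fine (Vol [set v | A (ins ord0 s v)]).
have aE s : (a s)%:E = Vol [set v | A (ins ord0 s v)].
  by rewrite fineK//; apply: Vol_compact_fin; exact: compact_sect.
have a0 s : 0 <= a s by rewrite -lee_fin aE Vol_ge0.
have [M M0 AM] := compact_coord_bounded cA.
have aM : ubound (range a) ((M *+ 2) ^+ n).
  move=> _ [s _ <-]; rewrite -lee_fin aE; apply: Vol_bounded; first exact: ltW.
    by apply: compact_measurable_rV; exact: compact_sect.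
  by move=> x i Ax; rewrite -(ins_lift ord0 s); exact: AM.
have hs : has_sup (range a) by split; [exists (a 0), 0|exists ((M *+ 2) ^+ n)].
pose al := sup (range a).
have aal s : a s <= al by apply: (sup_upper_bound hs); exists s.
have al0 : 0 < al.
  rewrite lt_neqAle (le_trans (a0 0))// andbT; apply/negP => /eqP al0.
  move: A0; rewrite VolS integral0_eq ?ltxx// => s _.
  by rewrite -aE; congr (_%:E); apply/eqP; rewrite eq_le a0 andbT al0.
have ma : measurable_fun setT a by exact: measurable_fine_sect.
have lev (t s : R) : (t <= a s / al) = (t * al <= a s) by rewrite ler_pdivlMr.
exists al, (fun s => a s / al); split => //.
- by move=> s; rewrite mulrC divfK ?gt_eqF.
- exact: measurable_funM.
- rewrite VolS -ge0_integralZl//.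
  + by apply: eq_integral => s _; rewrite -aE -EFinM mulrC divfK ?gt_eqF.
  + by apply/measurable_EFinP; exact: measurable_funM.
  + by move=> s _; rewrite lee_fin divr_ge0// ltW.
  + by rewrite lee_fin ltW.
split.
- by move=> x; rewrite divr_ge0 ?(ltW al0)//= ler_pdivrMr ?mul1r.
- move=> t /andP[t0 t1]; have e0 : 0 < al - t * al by rewrite subr_gt0 gtr_pMl.
  have [_ [s _ <-] hs'] := sup_adherent e0 hs.
  by exists s; rewrite lev ltW// (le_lt_trans _ hs')// subKr.
- move=> t /andP[t0 t1] x y /=; rewrite !lev => tx ty z /andP[xz zy].
  have [xy|xy] := eqVneq x y.
    by rewrite (_ : z = x) ?lev//; apply/eqP; rewrite eq_le xz {1}xy zy.
  have yx : 0 < y - x by rewrite subr_gt0 lt_neqAle xy (le_trans xz).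
  pose l := (z - x) / (y - x).
  have zE : z = (1 - l) * x + l * y.
    rewrite (_ : _ + _ = x + l * (y - x)); last by ring.
    by rewrite /l divfK ?gt_eqF// addrC subrK.
  (* Endpoints are set apart because the inequality requires a weight strictly between 0 and 1. *)
  have [->|xz'] := eqVneq z x; first by rewrite lev.
  have [->|zy'] := eqVneq z y; first by rewrite lev.
  have l01 : 0 < l < 1.
    apply/andP; split.
      by rewrite divr_gt0// subr_gt0 lt_neqAle eq_sym xz' xz.
    by rewrite ltr_pdivrMr// mul1r ltrD2r lt_neqAle zy' zy.
  have tal : 0 < t * al by rewrite mulr_gt0.
  (* Both outer slices have volume at least [t * al], and the geometric mean of this bound with
     itself is the bound again. *)
  rewrite lev -lee_fin aE -[t * al](powR_prod_conv l tal).
  apply: (BM [set v | A (ins ord0 x v)] [set v | A (ins ord0 y v)]) => //.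
  + exact: compact_sect.
  + exact: compact_sect.
  + exact: compact_sect.
  + exact: convex_sect.
  + exact: convex_sect.
  + move=> u v /= Au Av; rewrite zE -insD -!insZ; move/convex_setP : vA; apply => //.
    by case/andP: l01 => /ltW-> /ltW->.
  + by rewrite -aE lee_fin.
  + by rewrite -aE lee_fin.
- move=> t t01.
  apply: (@le_lt_trans _ _ (leb `[- M, M]%classic)); last first.
    rewrite lebesgue_measure_itv/=; case: ifPn => _; last exact: ltry.
    by rewrite -EFinB ltry.
  apply: le_measure; rewrite ?inE//.
    have ml : measurable_fun setT (fun s : R => t <= a s / al).
      by apply: measurable_fun_ler => //; exact: measurable_funM.
    by have := ml measurableT [set true]; rewrite setTI; exact.
  move=> s /=; rewrite in_itv/= -ler_norml lev => ts.
  apply: contrapT => /negP; rewrite -ltNge => Ms.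
  suff : a s = 0 by apply/eqP; rewrite gt_eqF// (lt_le_trans _ ts)// mulr_gt0//; case/andP: t01.
  apply: EFin_inj; rewrite aE (_ : mkset _ = set0) ?Vol_set0//.
  apply/seteqP; split => // v /= /(AM _ ord0); rewrite ins_at.
  by rewrite leNgt Ms.
Qed.

(** The inequality on the line is applied to the normalized slice volumes of [A] and [B], and to
    those of [C] divided by [ga], the geometric mean of the two suprema. Its hypothesis at level [t]
    is the statement one dimension lower. *)
Lemma brunn_minkowski_mul n : brunn_minkowski_dim n.
Proof.
elim: n => [|n IH] A B C l a b l01 cA cB cC vA vB ABC a0 b0 aA bB.
  (* In dimension 0 a set of positive volume is the single point, of volume 1, so both bounds are at
     most 1. *)
  have nV (D : set 'rV[R]_0) d : 0 < d -> (d%:E <= Vol D)%E -> D 0 /\ d <= 1.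
    move=> d0; rewrite Vol0 /dirac indicE lee_fin.
    have [/set_mem D0 |_] := boolP (0 \in D); first by split.
    by rewrite leNgt d0.
  have [A0 a1] := nV _ _ a0 aA; have [B0 b1] := nV _ _ b0 bB.
  have := ABC _ _ A0 B0; rewrite !scaler0 addr0 => C0.
  rewrite Vol0 /dirac indicE mem_set// lee_fin.
  apply: le_trans (powR_mean_le l01 a0 b0) _.
  have [l0 l1] := andP l01.
  rewrite -[leRHS](subrK l) lerD// ?ger_pMr//; first by rewrite subr_gt0.
have [l0 l1] := andP l01.
have [al [f [al0 fE mf VA [f01 nf If ff]]]] :=
  sect_profile IH cA vA (lt_le_trans (ltac:(by rewrite lte_fin) : (0 < a%:E)%E) aA).
have [be [g [be0 gE mg VB [g01 ng Ig fg]]]] :=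
  sect_profile IH cB vB (lt_le_trans (ltac:(by rewrite lte_fin) : (0 < b%:E)%E) bB).
pose ga := al `^ (1 - l) * be `^ l.
have ga0 : 0 < ga by rewrite mulr_gt0 ?powR_gt0.
pose c s := fine (Vol [set v | C (ins ord0 s v)]).
have cE s : (c s)%:E = Vol [set v | C (ins ord0 s v)].
  by rewrite fineK//; apply: Vol_compact_fin; exact: compact_sect.
have c0 s : 0 <= c s by rewrite -lee_fin cE Vol_ge0.
have mc : measurable_fun setT c by exact: measurable_fine_sect.
have VC : Vol C = (ga%:E * \int[leb]_s (c s / ga)%:E)%E.
  rewrite VolS -ge0_integralZl//.
  + by apply: eq_integral => s _; rewrite -cE -EFinM mulrC divfK ?gt_eqF.
  + by apply/measurable_EFinP; exact: measurable_funM.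
  + by move=> s _; rewrite lee_fin divr_ge0// ltW.
  + by rewrite lee_fin ltW.
have PL : ((1 - l)%:E * \int[leb]_s (f s)%:E + l%:E * \int[leb]_s (g s)%:E <=
    \int[leb]_s (c s / ga)%:E)%E.
  apply: prekopa_leindler_line => //.
  - exact: measurable_funM.
  - by move=> x; rewrite divr_ge0// ltW.
  move=> t s1 s2 /andP[t0 t1] tf tg; rewrite ler_pdivlMr//.
  (* The level [t] splits as [t]^ (1 - l) * t [^ l], so the scale [ga] turns level [t] of both
     profiles into the bound given by the induction hypothesis. *)
  have tga : t * ga = (t * al) `^ (1 - l) * (t * be) `^ l.
    rewrite !powRM ?ltW// mulrACA /ga; congr (_ * _).
    by rewrite powR_prod_conv.
  rewrite -lee_fin cE tga.
  apply: (IH [set v | A (ins ord0 s1 v)] [set v | B (ins ord0 s2 v)]) => //.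
  + exact: compact_sect.
  + exact: compact_sect.
  + exact: compact_sect.
  + exact: convex_sect.
  + exact: convex_sect.
  + by move=> u v /= Au Bv; rewrite -insD -!insZ; exact: ABC.
  + exact: mulr_gt0.
  + exact: mulr_gt0.
  + by rewrite fE lee_fin mulrC ler_pM2l.
  + by rewrite gE lee_fin mulrC ler_pM2l.
have [fA fAE] := fin_num_mulel al0 (Vol_compact_fin cA) VA.
have [fB fBE] := fin_num_mulel be0 (Vol_compact_fin cB) VB.
have [fC fCE] := fin_num_mulel ga0 (Vol_compact_fin cC) VC.
move: PL; rewrite -(fineK fA) -(fineK fB) -(fineK fC) -!EFinM -EFinD lee_fin.
rewrite fAE fBE fCE ler_pdivlMr// => PL.
have va : a <= fine (Vol A) by rewrite -lee_fin fineK// Vol_compact_fin.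
have vb : b <= fine (Vol B) by rewrite -lee_fin fineK// Vol_compact_fin.
rewrite -(fineK (Vol_compact_fin cC)) lee_fin; apply: le_trans PL.
have xa : 0 < fine (Vol A) / al by rewrite divr_gt0// (lt_le_trans a0).
have yb : 0 < fine (Vol B) / be by rewrite divr_gt0// (lt_le_trans b0).
(* The arithmetic mean from the line is weakened to a geometric one, whose factors merge with those
   of [ga] and cancel the normalization. *)
apply: (@le_trans _ _ ((fine (Vol A) / al) `^ (1 - l) * (fine (Vol B) / be) `^ l * ga)); last first.
  by rewrite ler_pM2r//; exact: powR_mean_le.
rewrite /ga mulrACA -!powRM ?(ltW xa) ?(ltW yb) ?(ltW al0) ?(ltW be0)// !divfK ?gt_eqF//.
apply: ler_pM; rewrite ?powR_ge0//; apply: ge0_ler_powR;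
  rewrite ?nnegrE ?subr_ge0 ?(ltW l0) ?(ltW l1) ?(ltW a0) ?(ltW b0)//.
- exact: le_trans (ltW a0) va.
- exact: le_trans (ltW b0) vb.
Qed.

End prekopa_leindler.

(** * Interiors of convex sets *)

Section interior.
Context {R : realType}.
Local Notation leb := (@lebesgue_measure R).
Local Notation borel n := (borel_rV (R := R) n).

Lemma rV_ballP n (x y : 'rV[R]_n) e : 0 < e ->
  ball x e y <-> forall i, `|y ord0 i - x ord0 i| < e.
Proof.
move=> e0; split => [[_ h] i|h]; first by have := h ord0 i; rewrite /ball/= distrC.
by split => // i j; rewrite (ord1 i) /ball/= distrC.
Qed.

(** A function that vanishes outside one point has integral 0. *)
Lemma positive_slices (f : R -> \bar R) :
  (0 < \int[leb]_s f s)%E -> exists s1 s2, [/\ s1 < s2, f s1 != 0%E & f s2 != 0%E].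
Proof.
move=> If; apply: contrapT => H.
suff [s0 s0P] : exists s0, [set s | f s != 0%E] `<=` [set s0].
  move: If; rewrite [X in (0 < X)%E](_ : _ = 0%E) ?ltxx//.
  rewrite [LHS](_ : _ = \int[leb]_(s in [set s | f s != 0%E]) f s)%E; last first.
    rewrite [RHS]integral_mkcond; apply: eq_integral => s _; rewrite patchE.
    by case: ifPn => //; rewrite notin_setE/= => /negP; rewrite negbK => /eqP.
  exact: integral_Sset1 s0P.
have [[s0 fs0]|N] := pselect (exists s0, f s0 != 0%E); last first.
  by exists 0 => s /= fs; exfalso; apply: N; exists s.
exists s0 => s /= fs; apply: contrapT => /eqP.
by rewrite neq_lt => /orP[ss|ss]; apply: H; [exists s, s0|exists s0, s].
Qed.

(** Two slices of positive volume contain balls by induction, and the hull of these two balls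
    contains a ball around the midpoint of their centres. *)
Lemma convex_ball n (A : set 'rV[R]_n) : convex_set A -> (0 < Vol A)%E ->
  exists p r, 0 < r /\ ball p r `<=` A.
Proof.
elim: n A => [|n IH] A vA A0.
  exists 0, 1; split => // x _; rewrite (_ : x = 0); last by apply/rowP => -[].
  move: A0; rewrite Vol0 /dirac indicE.
  by have [/set_mem //|] := boolP (0 \in A); rewrite ltxx.
move: A0; rewrite VolS => /positive_slices[s1 [s2 [s12 As1 As2]]].
have pos s : Vol [set v | A (ins ord0 s v)] != 0%E -> (0 < Vol [set v | A (ins ord0 s v)])%E.
  by move=> ?; rewrite lt_neqAle eq_sym Vol_ge0 andbT.
have [p1 [r1 [r10 B1]]] := IH _ (convex_sect vA) (pos _ As1).
have [p2 [r2 [r20 B2]]] := IH _ (convex_sect vA) (pos _ As2).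
pose dl := s2 - s1; have dl0 : 0 < dl by rewrite subr_gt0.
pose r := Num.min r1 r2; have r0 : 0 < r by rewrite lt_min r10.
pose K := 1 + `|p2 - p1| / dl.
have K0 : 0 < K by rewrite ltr_wpDr// divr_ge0// ltW.
(* The bound [dl / 2] keeps the weight [l] below in [[0, 1]]; the bound [r / K] keeps the offset [w]
   below [r], where [K] accounts for the drift of the centre from [p1] to [p2]. *)
pose rho := Num.min (dl / 2) (r / K).
have rho0 : 0 < rho by rewrite lt_min !divr_gt0.
have rhor : rho * K <= r by rewrite -ler_pdivlMr// ge_min lexx orbT.
exists (ins ord0 ((s1 + s2) / 2) (2^-1 *: (p1 + p2))), rho; split => // x.
move=> /(rV_ballP _ _ rho0) xp.
pose s := x ord0 ord0; pose v := col' ord0 x.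
have xs : `|s - (s1 + s2) / 2| < rho by have := xp ord0; rewrite ins_at.
have xv j : `|v ord0 j - (p1 ord0 j + p2 ord0 j) / 2| < rho.
  by have := xp (lift ord0 j); rewrite ins_lift !mxE mulrC.
pose l := (s - s1) / dl.
have lE : l - 2^-1 = (s - (s1 + s2) / 2) / dl.
  by rewrite /l /dl; field; rewrite gt_eqF.
have lh : `|l - 2^-1| < rho / dl by rewrite lE normrM normfV (gtr0_norm dl0) ltr_pM2r ?invr_gt0.
have l01 : 0 <= l <= 1.
  have h : rho / dl <= 2^-1 by rewrite ler_pdivrMr// mulrC ge_min lexx.
  have := lt_le_trans lh h; rewrite ltr_norml => /andP[h1 h2].
  by apply/andP; split; lra.
(* The offset of [x] from the line joining the centres, added to both [p1] and [p2], exhibits [x] as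
   a combination of points of the two balls. *)
have [w wE] : exists w, w = v - ((1 - l) *: p1 + l *: p2) by eexists.
have wr j : `|w ord0 j| < r.
  apply: lt_le_trans rhor.
  have -> : w ord0 j = (v ord0 j - (p1 ord0 j + p2 ord0 j) / 2) -
      (l - 2^-1) * (p2 - p1) ord0 j by rewrite wE !mxE; field.
  rewrite (le_lt_trans (ler_normB _ _))// normrM /K mulrDr mulr1 ltr_leD//.
  by rewrite mulrA mulrAC ler_pM//; [exact: ltW|exact: coord_le_norm].
have -> : x = (1 - l) *: ins ord0 s1 (p1 + w) + l *: ins ord0 s2 (p2 + w).
  rewrite !insZ insD -(ins_col' ord0 x); congr ins.
    by rewrite -/s /l /dl; field; rewrite gt_eqF.
  rewrite -/v !scalerDr addrACA -scalerDl subrK scale1r wE.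
  by rewrite addrCA subrr addr0.
move/convex_setP : vA; apply => //.
  apply: B1; apply/rV_ballP => // i; rewrite mxE addrAC subrr add0r.
  by rewrite (lt_le_trans (wr i))// ge_min lexx.
apply: B2; apply/rV_ballP => // i; rewrite mxE addrAC subrr add0r.
by rewrite (lt_le_trans (wr i))// ge_min lexx orbT.
Qed.

(** Shrinking [A] by a factor [1 - d] towards the centre of a ball inside it gives a copy that lies
    in the interior and has volume [(1 - d) ^+ n] times that of [A]; then [d] is taken small. *)
Lemma Vol_interior n (A : set 'rV[R]_n) : compact A -> convex_set A ->
  (0 < Vol A)%E -> Vol A° = Vol A.
Proof.
move=> cA vA A0; have [p [r [r0 pA]]] := convex_ball vA A0.
have mI : measurable (A° : set (borel n)) by apply: open_measurable_rV; exact: open_interior.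
have mA : measurable (A : set (borel n)) by exact: compact_measurable_rV.
have leIA : (Vol A° <= Vol A)%E by apply: Vol_le => //; exact: interior_subset.
apply/eqP; rewrite eq_le leIA/=; apply/lee_addgt0Pr => e e0.
have fA := Vol_compact_fin cA.
pose V := fine (Vol A); have V0 : 0 <= V by rewrite fine_ge0// Vol_ge0.
(* By Bernoulli the loss of volume is at most [n * d * V], which this choice keeps below [e]; the
   added 1 keeps the denominator positive. *)
pose d := Num.min 2^-1 (e / (n%:R * V + 1)).
have nV : 0 < n%:R * V + 1 by rewrite ltr_wpDl// mulr_ge0.
have d0 : 0 < d by rewrite lt_min invr_gt0 ltr0n divr_gt0.
have d1 : d < 1 by rewrite (@le_lt_trans _ _ 2^-1) ?ge_min ?lexx// invf_lt1 ?ltr1n.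
have c0 : 0 < 1 - d by rewrite subr_gt0.
have subI : [set x | A ((1 - d)^-1 *: (x - d *: p))] `<=` A°.
  move=> x /= Ax; rewrite /interior; apply/nbhs_ballP; exists (d * r) => /=.
    exact: mulr_gt0.
  move=> y /rV_ballP; rewrite mulr_gt0// => /(_ isT) xy.
  (* The whole displacement [y - x] is moved into the ball around [p], where it is magnified by
     [d^-1]. *)
  have -> : y = (1 - d) *: ((1 - d)^-1 *: (x - d *: p)) + d *: (p + d^-1 *: (y - x)).
    rewrite scalerA divff ?gt_eqF// scale1r scalerDr scalerA divff ?gt_eqF// scale1r.
    by rewrite addrA subrK addrCA subrr addr0.
  move/convex_setP : (vA); apply => //; first by rewrite !ltW.
  apply: pA; apply/rV_ballP => // i; rewrite !mxE addrAC subrr add0r.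
  by rewrite normrM normfV (gtr0_norm d0) mulrC ltr_pdivrMr// mulrC.
have mS : measurable ([set x | A ((1 - d)^-1 *: (x - d *: p))] : set (borel n)).
  have mf : measurable_fun setT (fun x : borel n => (1 - d)^-1 *: (x - d *: p) : borel n).
    apply: measurable_fun_rV => i; under eq_fun do rewrite !mxE.
    apply: measurable_funM => //; apply: measurable_funB => //.
    exact: measurable_coord.
  by rewrite -[X in measurable X]setTI; exact: (mf measurableT _ mA).
apply: (@le_trans _ _ ((1 - d) ^+ n * V + e)%:E); last first.
  by rewrite EFinD leeD2r// EFinM fineK// -(Vol_affine (d *: p))//; exact: Vol_le.
rewrite -[leLHS]fineK// lee_fin -/V.
have bern : 1 - n%:R * d <= (1 - d) ^+ n.
  elim: (n) => [|k IHk]; first by rewrite mul0r subr0 expr0.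
  rewrite exprS -natr1; apply: le_trans (ler_wpM2l (ltW c0) IHk).
  rewrite -subr_ge0 [X in 0 <= X](_ : _ = k%:R * d * d); last by ring.
  by rewrite !mulr_ge0// ltW.
apply: (@le_trans _ _ ((1 - n%:R * d) * V + e)); last by rewrite lerD2r ler_wpM2r.
rewrite mulrBl mul1r -addrA lerDl addrC subr_ge0 mulrAC.
have dE : d * (n%:R * V + 1) <= e by rewrite -ler_pdivlMr// ge_min lexx orbT.
apply: le_trans dE; rewrite mulrC mulrDr mulr1 lerDl; exact: ltW.
Qed.

End interior.

(** * Cones over the floor *)

Section convex_hull.
Context {R : realType} {n : nat}.
Implicit Types (A S : set 'rV[R]_n).

Lemma convex_hull_convex S : convex_set (convex_hull S).
Proof.
apply/convex_setP => x y t t01 hx hy B [cB SB].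
by move/convex_setP : (cB); apply; [|exact: hx|exact: hy].
Qed.

Lemma sub_convex_hull S : S `<=` convex_hull S.
Proof. exact: sub_smallest. Qed.

Lemma convex_hull_sub S A : convex_set A -> S `<=` A -> convex_hull S `<=` A.
Proof. exact: smallest_sub. Qed.

(** Merges two weighted points into one without a division where it is used; when both weights
    vanish, any point of [A] serves. *)
Lemma convex_conic A (a b : R) p q : convex_set A -> 0 <= a -> 0 <= b ->
  A p -> A q -> exists2 r, A r & a *: p + b *: q = (a + b) *: r.
Proof.
move=> /convex_setP cA a0 b0 Ap Aq.
have [ab|ab] := eqVneq (a + b) 0.
  have [-> ->] : a = 0 /\ b = 0 by split; lra.
  by exists p => //; rewrite addr0 !scale0r addr0.
have ab0 : 0 < a + b by rewrite lt_neqAle eq_sym ab addr_ge0.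
exists ((1 - b / (a + b)) *: p + (b / (a + b)) *: q).
  apply: cA => //; rewrite divr_ge0 ?(ltW ab0)//= ler_pdivrMr// mul1r.
  by rewrite lerDr.
by rewrite scalerDr !scalerA; congr (_ *: _ + _ *: _); field.
Qed.

End convex_hull.

Section cone.
Context {R : realType} {m : nat}.
Implicit Types (F G : set 'rV[R]_m) (x y : 'rV[R]_m.+1) (S : set 'rV[R]_m.+1).

Definition hgt x : R := x ord0 ord_max.

Definition cone F y : set 'rV[R]_m.+1 :=
  [set q | exists f t, [/\ F f, 0 <= t <= 1 & q = (1 - t) *: ins ord_max 0 f + t *: y]].

(* The point of the floor hyperplane on the line through [y] and [x]. *)
Definition shadow x y : 'rV[R]_m :=
  (hgt y - hgt x)^-1 *: (hgt y *: col' ord_max x - hgt x *: col' ord_max y).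

(** For [p.2] above the floor, [p.1] lies in the cone over [G] with apex [p.2], base and apex
    removed. The strict inequalities keep the denominator in [shadow] positive, and the condition is
    measurable in both points jointly. *)
Definition below G : set ('rV[R]_m.+1 * 'rV[R]_m.+1) :=
  [set p | 0 < hgt p.1 < hgt p.2 /\ G (shadow p.1 p.2)].

Lemma hgt_ins (s : R) v : hgt (ins ord_max s v) = s.
Proof. exact: ins_at. Qed.

Lemma hgtD x y : hgt (x + y) = hgt x + hgt y.
Proof. by rewrite /hgt mxE. Qed.

Lemma hgtZ a x : hgt (a *: x) = a * hgt x.
Proof. by rewrite /hgt mxE. Qed.

Lemma col'D x y : col' ord_max (x + y) = col' ord_max x + col' ord_max y.
Proof. by apply/rowP => i; rewrite !mxE. Qed.

Lemma col'Z a x : col' ord_max (a *: x) = a *: col' ord_max x.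
Proof. by apply/rowP => i; rewrite !mxE. Qed.

Lemma floor_setE F : floor_set F = [set ins ord_max 0 f | f in F].
Proof.
apply/seteqP; split => [x [Fx x0]|_ [f Ff <-]].
  by exists (col' ord_max x) => //; rewrite -x0 ins_col'.
by split; rewrite ?col'_ins ?ins_at.
Qed.

Lemma cone_apex F y : F !=set0 -> cone F y y.
Proof.
move=> [f Ff]; exists f, 1; split => //; first by rewrite ler01 lexx.
by rewrite subrr scale0r add0r scale1r.
Qed.

Lemma floor_sub_cone F y : floor_set F `<=` cone F y.
Proof.
rewrite floor_setE => _ [f Ff <-]; exists f, 0; split => //.
  by rewrite lexx ler01.
by rewrite subr0 scale1r scale0r addr0.
Qed.

Lemma cone_convex F y : convex_set F -> convex_set (cone F y).
Proof.
move=> cF; apply/convex_setP => p q t /andP[t0 t1].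
move=> [f [a [Ff /andP[a0 a1] ->]]] [g [b [Fg /andP[b0 b1] ->]]].
have [] := @convex_conic _ _ F ((1 - t) * (1 - a)) (t * (1 - b)) f g cF.
- by rewrite mulr_ge0// subr_ge0.
- by rewrite mulr_ge0// subr_ge0.
- by [].
- by [].
move=> r Fr rE; exists r, ((1 - t) * a + t * b); split => //.
  by apply/andP; split; nra.
rewrite !scalerDr !scalerA addrACA -scalerDl; congr (_ + _).
rewrite !insZ insD !mulr0 addr0 rE; congr (ins _ _ (_ *: _)); ring.
Qed.

Lemma cone_sub F y S : convex_set S -> floor_set F `<=` S -> S y -> cone F y `<=` S.
Proof.
move=> /convex_setP cS FS Sy _ [f [t [Ff t01 ->]]]; apply: cS => //.
by apply: FS; rewrite floor_setE; exists f.
Qed.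

Lemma convex_hull_cone F y : F !=set0 -> convex_set F ->
  convex_hull (floor_set F `|` [set y]) = cone F y.
Proof.
move=> F0 cF; apply/seteqP; split.
  apply: convex_hull_sub; first exact: cone_convex.
  by move=> x [|->]; [exact: floor_sub_cone|exact: cone_apex].
apply: cone_sub; first exact: convex_hull_convex.
  by move=> x Fx; apply: sub_convex_hull; left.
by apply: sub_convex_hull; right.
Qed.

Lemma shadow_cone F x y : 0 < hgt x < hgt y -> F (shadow x y) -> cone F y x.
Proof.
move=> /andP[x0 xy] Fs; have y0 := lt_trans x0 xy.
have yx : hgt y - hgt x != 0 by rewrite subr_eq0 gt_eqF.
exists (shadow x y), (hgt x / hgt y); split => //.
  by rewrite divr_ge0 ?(ltW x0) ?(ltW y0)//= ler_pdivrMr// mul1r ltW.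
rewrite -[LHS](ins_col' ord_max) -[X in _ = _ + _ *: X](ins_col' ord_max) !insZ insD.
rewrite -[y ord0 ord_max]/(hgt y) -[x ord0 ord_max]/(hgt x).
congr ins; first by field; rewrite gt_eqF.
rewrite /shadow !scalerA !scalerBr !scalerA.
have -> : (1 - hgt x / hgt y) / (hgt y - hgt x) * hgt y = 1.
  by field; rewrite yx gt_eqF.
have -> : (1 - hgt x / hgt y) / (hgt y - hgt x) * hgt x = hgt x / hgt y.
  by field; rewrite yx gt_eqF.
by rewrite scale1r subrK.
Qed.

Lemma cone_shadow F x y : 0 < hgt x -> hgt x != hgt y -> 0 <= hgt y ->
  cone F y x -> below F (x, y).
Proof.
move=> x0 xy y0 [f [t [Ff /andP[t0 t1] xE]]].
have hx : hgt x = t * hgt y by rewrite xE hgtD !hgtZ hgt_ins mulr0 add0r.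
have xlty : hgt x < hgt y by rewrite lt_neqAle xy hx ler_piMl.
split; first by rewrite /= x0.
rewrite /= /shadow; have -> : col' ord_max x = (1 - t) *: f + t *: col' ord_max y.
  by rewrite xE col'D !col'Z col'_ins.
rewrite [hgt y *: _]scalerDr !scalerA [hgt y * t]mulrC -hx addrK scalerA.
rewrite (_ : _ * _ = 1) ?scale1r// hx; field.
by rewrite -hx subr_eq0 gt_eqF.
Qed.

(** The hull lies in the union [D] of segments from [x] to the cone of [y]. If [x] is interior, it
    can be pushed slightly away from a floor point [p]: [x + d (x - p) = a x + (1 - a) q] with [q]
    in the cone. Solving for [x] makes it a convex combination of [p] and [q]. *)
Lemma interior_hull_cone F S x y : F !=set0 -> convex_set F ->
  S `<=` [set x] `|` [set y] `|` floor_set F ->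
  (convex_hull S)° x -> cone F y x.
Proof.
move=> [f0 Ff0] cF Sxy hx; have cC : convex_set (cone F y) by exact: cone_convex.
pose D : set 'rV[R]_m.+1 :=
  [set q | exists a p, [/\ 0 <= a <= 1, cone F y p & q = a *: x + (1 - a) *: p]].
have hD : convex_hull S `<=` D.
  apply: convex_hull_sub.
    apply/convex_setP => p q t /andP[t0 t1].
    move=> [a [p' [/andP[a0 a1] Cp ->]]] [b [q' [/andP[b0 b1] Cq ->]]].
    have [] := @convex_conic _ _ (cone F y) ((1 - t) * (1 - a)) (t * (1 - b)) p' q' cC.
    - by rewrite mulr_ge0// subr_ge0.
    - by rewrite mulr_ge0// subr_ge0.
    - by [].
    - by [].
    move=> r Cr rE; exists ((1 - t) * a + t * b), r; split => //.
      by apply/andP; split; nra.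
    rewrite !scalerDr !scalerA addrACA -scalerDl; congr (_ + _).
    by rewrite rE; congr (_ *: _); ring.
  have Cy : cone F y y by apply: cone_apex; exists f0.
  move=> q /Sxy[[->|->]|Fq].
  - by exists 1, y; rewrite subrr scale0r addr0 scale1r ler01 lexx.
  - by exists 0, y; rewrite subr0 scale0r add0r scale1r ler01 lexx.
  - exists 0, q; rewrite subr0 scale0r add0r scale1r ler01 lexx; split => //.
    exact: floor_sub_cone.
pose p := ins ord_max 0 f0.
have Cp : cone F y p by apply: floor_sub_cone; rewrite floor_setE; exists f0.
have /nbhs_ballP[e /= e0 eH] := hx.
pose N := `|x - p| + 1; have N0 : 0 < N by rewrite ltr_wpDl.
(* Every coordinate of [d (x - p)] is then below [e], also when [x = p]. *)
pose d := e / N / 2; have d0 : 0 < d by rewrite !divr_gt0.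
have : D (x + d *: (x - p)).
  apply: hD; apply: eH; apply/rV_ballP => // i.
  rewrite mxE addrAC subrr add0r mxE normrM (gtr0_norm d0).
  apply: (@le_lt_trans _ _ (d * `|x - p|)).
    by rewrite ler_pM2l//; exact: coord_le_norm.
  apply: (@le_lt_trans _ _ (d * N)); first by rewrite ler_pM2l// lerDl.
  rewrite (_ : d * N = e / 2); last by rewrite /d; field; rewrite gt_eqF.
  by rewrite ltr_pdivrMr// ltr_pMr// ltr1n.
move=> [a [q [/andP[a0 a1] Cq E]]].
have [r Cr rE] := convex_conic cC (ltW d0) (ltac:(by rewrite subr_ge0) : 0 <= 1 - a) Cp Cq.
have w0 : 0 < d + (1 - a) by rewrite ltr_pwDl// subr_ge0.
suff -> : x = r by [].
have : (d + (1 - a)) *: x = (d + (1 - a)) *: r.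
  rewrite -rE; move/eqP: E; rewrite -subr_eq0 => /eqP E.
  apply/eqP; rewrite -subr_eq0; apply/eqP; rewrite -[RHS]E.
  by apply/rowP => i; rewrite !mxE; ring.
by move/(congr1 ( *:%R (d + (1 - a))^-1)); rewrite !scalerA mulVf ?gt_eqF// !scale1r.
Qed.

(** The shadow and the height depend continuously on [x], and membership in [F°] and the strict
    inequalities are open conditions, so a neighbourhood of [x] stays in the cone. *)
Lemma below_interior_hull F S x y :
  [set y] `|` floor_set F `<=` S -> below F° (x, y) -> (convex_hull S)° x.
Proof.
move=> yFS [/= hxy Fs].
have cy : nbhs x (cone F y).
  have hc : {for x, continuous hgt} by exact: coord_continuous.
  have n1 : \forall z \near x, 0 < hgt z.
    apply: (hc [set r | 0 < r]); apply: open_nbhs_nbhs.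
    by split; [exact: open_gt|case/andP: hxy].
  have n2 : \forall z \near x, hgt z < hgt y.
    apply: (hc [set r | r < hgt y]); apply: open_nbhs_nbhs.
    by split; [exact: open_lt|case/andP: hxy].
  have n3 : \forall z \near x, F° (shadow z y).
    have : nbhs (shadow x y) F° by exact: nbhs_interior.
    suff : {for x, continuous (shadow ^~ y)} by apply.
    apply: continuous_rV_at => j.
    have -> : (fun z => shadow z y ord0 j) = fun z => (hgt y - hgt z)^-1 *
        (hgt y * z ord0 (lift ord_max j) - hgt z * y ord0 (lift ord_max j)).
      by apply/funext => z; rewrite !mxE.
    have cc c : {for x, continuous (fun=> c : R)}.
      exact: (@cvg_cst _ c _ (nbhs x) _).
    have h1 : {for x, continuous (fun z => hgt y - hgt z)} := continuousB (cc (hgt y)) hc.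
    have yx : hgt y - hgt x != 0 by rewrite subr_eq0 gt_eqF//; case/andP: hxy.
    have hz : {for x, continuous (fun z : 'rV[R]_m.+1 => z ord0 (lift ord_max j))}.
      exact: coord_continuous.
    exact: (continuousM (@continuousV _ _ (fun z => hgt y - hgt z) x yx h1)
      (continuousB (continuousM (cc (hgt y)) hz)
                   (continuousM hc (cc (y ord0 (lift ord_max j)))))).
  near=> z; apply: shadow_cone.
    by apply/andP; split; [near: z|near: z].
  by apply: interior_subset; near: z.
apply: filterS cy; apply: cone_sub; first exact: convex_hull_convex.
  by move=> z Fz; apply: sub_convex_hull; apply: yFS; right.
by apply: sub_convex_hull; apply: yFS; left.
Unshelve. all: by end_near. Qed.

End cone.

(** * Iterated integrals over pairs, and integrals of affine powers *)

Section integral_aux.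
Context {R : realType}.
Local Open Scope ereal_scope.
Local Notation leb := (@lebesgue_measure R).

(* No measurability is needed: the integral of a nonnegative function is the
   supremum of the integrals of the simple functions below it. *)
Lemma ge0_le_integral_simple d (T : measurableType d)
    (mu : {measure set T -> \bar R}) (f g : T -> \bar R) :
  (forall x, 0 <= f x) -> (forall x, f x <= g x) ->
  \int[mu]_x f x <= \int[mu]_x g x.
Proof.
move=> f0 fg; have g0 x : 0 <= g x by exact: le_trans (fg x).
rewrite !ge0_integralTE//; apply: ereal_sup_le => _ [h hf <-].
by exists h => // x; apply: le_trans (fg x); exact: hf.
Qed.

Lemma tuple_measure2E d (T : measurableType d) (mu : {measure set T -> \bar R})
    (A : set (2.-tuple T)) :
  tuple_measure mu A = \int[mu]_x \int[mu]_y (\1_[set y | A [tuple x; y]] y)%:E.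
Proof.
rewrite [LHS]/= /product_measure1; apply: eq_integral => x _ /=.
rewrite /product_measure1; apply: eq_integral => y _ /=.
rewrite /dirac !indicE; congr ((nat_of_bool _)%:R%:E).
have e : [tuple of x :: [tuple of y :: [tuple]]] = [tuple x; y] :> 2.-tuple T.
  exact/val_inj.
by apply/idP/idP => /set_mem h; apply/mem_set; move: h;
  rewrite /xsection/= !inE/= ?inE/= ?e.
Qed.

Lemma product_measure_indic d1 d2 (T1 : measurableType d1) (T2 : measurableType d2)
    (m1 : {measure set T1 -> \bar R}) (m2 : {sigma_finite_measure set T2 -> \bar R})
    (B : set (T1 * T2)) : measurable B ->
  (m1 \x m2) B = \int[m1]_x \int[m2]_y (\1_B (x, y))%:E.
Proof.
move=> mB; apply: eq_integral => x _ /=.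
rewrite -(setIT (xsection B x)) -integral_indic//; last exact: measurable_xsection.
apply: eq_integral => y _; rewrite !indicE; congr ((nat_of_bool _)%:R%:E).
by apply/idP/idP => /set_mem h; apply/mem_set; move: h; rewrite /xsection/= inE.
Qed.

(** Here and in the next lemma [A] is arbitrary: iterated integrals of indicators are monotone
    without measurability, so a measurable [B] bounds [A] from one side. This is how the event in
    [Q] is handled. *)
Lemma tuple_measure2_ge d (T : measurableType d)
    (mu : {sigma_finite_measure set T -> \bar R})
    (A : set (2.-tuple T)) (B : set (T * T)) : measurable B ->
  (forall p, B p -> A [tuple p.1; p.2]) -> (mu \x mu) B <= tuple_measure mu A.
Proof.
move=> mB BA; rewrite tuple_measure2E product_measure_indic//.
apply: ge0_le_integral_simple => x; first exact: integral_ge0.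
apply: ge0_le_integral_simple => y //.
rewrite lee_fin !indicE ler_nat.
by have [/set_mem/BA Axy|] := boolP ((x, y) \in B); rewrite // mem_set.
Qed.

Lemma tuple_measure2_le d (T : measurableType d)
    (mu : {sigma_finite_measure set T -> \bar R})
    (A : set (2.-tuple T)) (B : set (T * T)) : measurable B ->
  (forall p, A [tuple p.1; p.2] -> B p) -> tuple_measure mu A <= (mu \x mu) B.
Proof.
move=> mB BA; rewrite tuple_measure2E product_measure_indic//.
apply: ge0_le_integral_simple => x; first exact: integral_ge0.
apply: ge0_le_integral_simple => y //.
rewrite lee_fin !indicE ler_nat.
by have [/set_mem/= /(BA (x, y)) Axy|] := boolP (y \in _); rewrite // mem_set.
Qed.

Lemma product_measure_swap d (T : measurableType d)
    (mu : {sigma_finite_measure set T -> \bar R}) (B : set (T * T)) :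
  measurable B -> (mu \x mu) B = (mu \x mu) [set p | B (p.2, p.1)].
Proof.
move=> mB.
have mB' : measurable [set p : T * T | B (p.2, p.1)].
  have ms : measurable_fun setT (fun p : T * T => (p.2, p.1)).
    by apply/measurable_fun_pairP; split; [exact: measurable_snd|exact: measurable_fst].
  by rewrite -[X in measurable X]setTI; exact: (ms measurableT _ mB).
rewrite !product_measure_indic//.
rewrite (@fubini_tonelli _ _ _ _ R mu mu (fun p => (\1_B p)%:E))//.
by apply/measurable_EFinP; exact: measurable_indic.
Qed.

(** The antiderivative is written as a polynomial [P], which supplies its derivative and continuity.
    The formula serves both the cones and the frustums. *)
Lemma integral_affine_pow (a b k : R) n : (0 < k)%R -> b != 0%R ->
  \int[leb]_(t in `[0%R, k]) ((a + b * t) ^+ n)%:E =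
  (((a + b * k) ^+ n.+1 - a ^+ n.+1) / (b * n.+1%:R))%:E.
Proof.
move=> k0 b0.
pose P : {poly R} := ((b * n.+1%:R)^-1 *: (a%:P + b *: 'X) ^+ n.+1)%R.
have P'E (t : R) : P^`().[t] = ((a + b * t) ^+ n)%R.
  rewrite /P derivZ deriv_exp derivD derivC derivZ derivX add0r !hornerE/=.
  by rewrite hornerMn !hornerE/= -mulr_natr; field; rewrite b0 nat1r pnatr_eq0.
have PE (t : R) : P.[t] = ((a + b * t) ^+ n.+1 / (b * n.+1%:R))%R.
  by rewrite /P !hornerE/= mulrC.
under eq_integral do rewrite -P'E.
rewrite (@continuous_FTC2 _ (horner P^`()) (horner P))//.
- by rewrite !PE mulr0 addr0 -EFinB -mulrBl.
- by apply: continuous_subspaceT; exact: continuous_horner.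
- split.
  + by move=> t _; exact: derivable_horner.
  + by apply: cvg_at_right_filter; exact: continuous_horner.
  + by apply: cvg_at_left_filter; exact: continuous_horner.
- by move=> t _; rewrite derive1E; have [_ ->] := is_derive_poly P t.
Qed.

End integral_aux.

(** * The uniform law and the volume of cones *)

Section uniform.
Context {R : realType} {n : nat} (K : set 'rV[R]_n).
Local Open Scope ereal_scope.
Local Notation borel n := (borel_rV (R := R) n).
Hypotheses (mK : measurable (K : set (borel n))) (K1 : Vol K = 1).

(* [K1] is an argument so that the probability instance can be inferred. *)
Definition ulaw of Vol K = 1 : set (borel n) -> \bar R := mrestr (@vol R n) mK.

Let ulaw0 : ulaw K1 set0 = 0.
Proof. exact: measure0. Qed.

Let ulaw_ge0 A : 0 <= ulaw K1 A.
Proof. exact: measure_ge0. Qed.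

Let ulaw_sigma_additive : semi_sigma_additive (ulaw K1).
Proof. exact: measure_semi_sigma_additive. Qed.

HB.instance Definition _ := isMeasure.Build _ _ _ (ulaw K1)
  ulaw0 ulaw_ge0 ulaw_sigma_additive.

Let ulawT : ulaw K1 setT = 1.
Proof. by rewrite /ulaw /mrestr setTI. Qed.

HB.instance Definition _ := Measure_isProbability.Build _ _ _ (ulaw K1) ulawT.

Lemma uniform_lawE : @uniform_law R n K = ulaw K1.
Proof.
by apply/funext => A; rewrite /uniform_law K1 /= invr1 mule1.
Qed.

Lemma ulaw_ae (f g : borel n -> \bar R) :
  measurable_fun setT f -> measurable_fun setT g ->
  (forall x, K x -> f x = g x) -> \int[ulaw K1]_x f x = \int[ulaw K1]_x g x.
Proof.
move=> mf mg fg; apply: ae_eq_integral => //.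
exists (~` K); split; first exact: measurableC.
  by change (vol (~` K `&` K) = 0); rewrite setICl measure0.
move=> x /= /not_implyP[_ fgx] Kx; apply: fgx; exact: fg.
Qed.

End uniform.

Section slices.
Context {R : realType} {m : nat}.
Local Open Scope ereal_scope.
Local Notation borel n := (borel_rV (R := R) n).
Local Notation leb := (@lebesgue_measure R).

Lemma measurable_hgt : measurable_fun setT (@hgt R m : borel m.+1 -> R).
Proof. exact: measurable_coord. Qed.

Lemma measurable_hgt_le (r : R) : measurable ([set x | (hgt x <= r)%R] : set (borel m.+1)).
Proof.
rewrite (_ : mkset _ = @hgt R m @^-1` `]-oo, r]%classic).
  by rewrite -[X in measurable X]setTI; exact: (measurable_hgt measurableT (measurable_itv _)).
by apply/seteqP; split => x /=; rewrite in_itv.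
Qed.

Lemma measurable_hgt_gt (r : R) : measurable ([set x | (r < hgt x)%R] : set (borel m.+1)).
Proof.
rewrite (_ : mkset _ = ~` [set x | (hgt x <= r)%R]).
  by apply: measurableC; exact: measurable_hgt_le.
by apply/seteqP; split => x /=; rewrite ltNge => /negP.
Qed.

Lemma measurable_below (G : set 'rV[R]_m) : measurable (G : set (borel m)) ->
  measurable (below G : set (borel m.+1 * borel m.+1)).
Proof.
move=> mG.
pose h1 (p : borel m.+1 * borel m.+1) : R := hgt p.1.
pose h2 (p : borel m.+1 * borel m.+1) : R := hgt p.2.
have mh1 : measurable_fun setT h1.
  exact: (measurableT_comp measurable_hgt measurable_fst).
have mh2 : measurable_fun setT h2.
  exact: (measurableT_comp measurable_hgt measurable_snd).
(* The inverse in [shadow] is written as a power with exponent -1, a measurable function that agrees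
   with it where the height difference is positive. *)
pose sh (p : borel m.+1 * borel m.+1) : borel m :=
  ((h2 p - h1 p) `^ (-1))%R *: (h2 p *: col' ord_max p.1 - h1 p *: col' ord_max p.2).
have msh : measurable_fun setT sh.
  apply: measurable_fun_rV => i; under eq_fun do rewrite !mxE.
  apply: measurable_funM.
    apply: (measurableT_comp (measurable_powR (-1))).
    exact: measurable_funB.
  apply: measurable_funB; apply: measurable_funM => //.
    exact: (measurableT_comp (measurable_coord _) measurable_fst).
  exact: (measurableT_comp (measurable_coord _) measurable_snd).
rewrite (_ : below G = (fun p => (0 < h1 p)%R && (h1 p < h2 p)%R) @^-1` [set true]
                       `&` sh @^-1` G).
  have mb : measurable_fun setT (fun p => (0 < h1 p)%R && (h1 p < h2 p)%R).
    by apply: measurable_and; exact: measurable_fun_ltr.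
  apply: measurableI; rewrite -[X in measurable X]setTI; first exact: mb.
  exact: (msh measurableT _ mG).
have e p : (0 < h1 p < h2 p)%R -> sh p = shadow p.1 p.2.
  by move=> /andP[_ h12]; rewrite /sh /shadow powR_inv1// subr_ge0 ltW.
by apply/seteqP; split => p [h12]; rewrite /= e.
Qed.

(** On a horizontal slice the shadow undoes a homothety of ratio [1 - t / hgt y] and a translation:
    the form to which [Vol_affine] applies. *)
Lemma shadow_slice (y : 'rV[R]_m.+1) (t : R) (v : 'rV[R]_m) : (0 < hgt y)%R -> (t < hgt y)%R ->
  shadow (ins ord_max t v) y =
  ((hgt y - t) / hgt y)^-1 *: (v - (t / hgt y) *: col' ord_max y).
Proof.
move=> y0 ty; rewrite /shadow hgt_ins col'_ins scalerBr scalerBr !scalerA.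
by congr (_ *: _ - _ *: _)%R; field; rewrite ?gt_eqF// subr_gt0.
Qed.

Lemma Vol_below_slice (G : set 'rV[R]_m) (y : 'rV[R]_m.+1) (t : R) :
  measurable (G : set (borel m)) -> (0 < t < hgt y)%R ->
  Vol [set v | below G (ins ord_max t v, y)] =
  ((1 - t / hgt y) ^+ m)%:E * Vol G.
Proof.
move=> mG /andP[t0 ty]; have y0 := lt_trans t0 ty.
have c0 : (0 < (hgt y - t) / hgt y)%R by rewrite divr_gt0// subr_gt0.
rewrite (_ : (1 - t / hgt y = (hgt y - t) / hgt y)%R); last first.
  by field; rewrite gt_eqF.
rewrite -(Vol_affine ((t / hgt y) *: col' ord_max y) c0 mG).
congr Vol; apply/seteqP; split => v /=.
  by move=> [/= _]; rewrite shadow_slice.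
by move=> Gv; split; [rewrite /= hgt_ins t0|rewrite /= shadow_slice].
Qed.

Lemma measurable_below_sect (G : set 'rV[R]_m) (y : 'rV[R]_m.+1) :
  measurable (G : set (borel m)) ->
  measurable ([set x | below G (x, y)] : set (borel m.+1)).
Proof.
move=> mG; rewrite (_ : mkset _ = ysection (below G : set (borel m.+1 * borel m.+1)) y).
  exact: (measurable_ysection _ (measurable_below mG)).
by apply/seteqP; split => x; rewrite /ysection/= inE.
Qed.

Lemma integral_cone_profile (k : R) : (0 < k)%R ->
  \int[leb]_(t in `]0%R, k[) ((1 - t / k) ^+ m)%:E = (k / m.+1%:R)%:E.
Proof.
move=> k0; have kn0 : k != 0%R by rewrite gt_eqF.
rewrite -(@integral_itv_bndoo _ 0%R k _ true false); last first.
  apply/measurable_EFinP; apply: measurable_funTS; apply: measurable_funX.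
  by apply: measurable_funB => //; exact: measurable_funM.
transitivity (\int[leb]_(t in `[0%R, k]) ((1 + (- k^-1) * t) ^+ m)%:E).
  by apply: eq_integral => t _; rewrite mulNr mulrC.
rewrite integral_affine_pow//; last by rewrite oppr_eq0 invr_eq0.
congr (_%:E); rewrite mulNr mulVf// subrr expr0n expr1n /= sub0r.
by field; rewrite kn0 nat1r pnatr_eq0.
Qed.

Lemma Vol_below (G : set 'rV[R]_m) (y : 'rV[R]_m.+1) :
  measurable (G : set (borel m)) -> Vol G = 1 -> (0 <= hgt y)%R ->
  Vol [set x | below G (x, y)] = (hgt y / m.+1%:R)%:E.
Proof.
move=> mG G1 y0; rewrite Vol_last; last exact: measurable_below_sect.
move: y0; rewrite le_eqVlt => /predU1P[y0|y0].
  rewrite -y0 mul0r integral0_eq// => t _.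
  rewrite (_ : mkset _ = set0) ?Vol_set0//.
  apply/seteqP; split => // v [/=]; rewrite -y0 => /andP[h1 h2].
  by have := lt_trans h1 h2; rewrite ltxx.
rewrite -integral_cone_profile// [RHS]integral_mkcond.
apply: eq_integral => t _; rewrite patchE; case: ifPn => [/set_mem|].
  by rewrite /= in_itv/= => ty; rewrite Vol_below_slice// G1 mule1.
move=> /negP ty; rewrite (_ : mkset _ = set0) ?Vol_set0//.
apply/seteqP; split => // v [/=]; rewrite hgt_ins => ty' _.
by apply: ty; rewrite inE/= in_itv.
Qed.

Lemma Vol_hyperplane (c : R) : Vol [set x : 'rV[R]_m.+1 | hgt x = c] = 0.
Proof.
rewrite Vol_last; last first.
  rewrite -[X in measurable X]setTI.
  by apply: (measurable_hgt measurableT (measurable_set1 c)).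
transitivity (\int[leb]_(t in [set c])
    Vol [set v : 'rV[R]_m | hgt (ins ord_max t v) = c]); last exact: integral_set1.
rewrite [RHS]integral_mkcond; apply: eq_integral => t _; rewrite patchE.
case: ifPn => // /negP tc; rewrite (_ : mkset _ = set0) ?Vol_set0//.
apply/seteqP; split => // v /=; rewrite hgt_ins => tc'.
by apply: tc; rewrite inE.
Qed.

End slices.

(** * The event in terms of the mean height *)

Section two_points.
Context {R : realType} {m : nat}.
Local Open Scope ereal_scope.
Local Notation borel n := (borel_rV (R := R) n).
Variables (F : set 'rV[R]_m) (K : set 'rV[R]_m.+1).
Hypotheses (cF : compact F) (vF : convex_set F) (F1 : Vol F = 1).
Hypotheses (mK : measurable (K : set (borel m.+1))) (vK : convex_set K).
Hypotheses (FK : floor_set F `<=` K) (K0 : forall x, K x -> (0 <= hgt x)%R).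
Hypothesis (K1 : Vol K = 1).

Let P := ulaw mK K1.

Let F0 : F !=set0.
Proof.
apply: contrapT => F0; move: F1; rewrite (_ : F = set0) ?Vol_set0.
  by move/eqP; rewrite eq_sym onee_eq0.
by apply/seteqP; split => // x Fx; apply: F0; exists x.
Qed.

Let good (U : 2.-tuple (borel m.+1)) := forall i : 'I_2,
  boundary (convex_hull (range (tnth U) `|` floor_set F)) (tnth U i).

Let range_pair (x y : borel m.+1) : range (tnth [tuple x; y]) = [set x] `|` [set y].
Proof.
apply/seteqP; split => z.
  by move=> [[[|[|//]] ?] _ <-]; [left|right].
by move=> [->|->]; [exists ord0|exists (lift ord0 ord0)].
Qed.

Let good_below (p : borel m.+1 * borel m.+1) : good [tuple p.1; p.2] ->
  ~ below F° p /\ ~ below F° (p.2, p.1).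
Proof.
case: p => x y /= gxy; split => bl.
  have [_] := gxy ord0; apply; apply: (below_interior_hull (y := y)) bl.
  by rewrite range_pair => z [->|Fz]; [left; right|right].
have [_] := gxy (lift ord0 ord0); apply; apply: (below_interior_hull (y := x)) bl.
by rewrite range_pair => z [->|Fz]; [left; left|right].
Qed.

(** The pairs for which being in the cone need not yield [below]: a point at height at most 0, or
    two equal heights. They form a null set. *)
Let degenerate : set (borel m.+1 * borel m.+1) :=
  [set p | (hgt p.1 <= 0)%R] `|` [set p | (hgt p.2 <= 0)%R]
  `|` [set p | hgt p.2 = hgt p.1].

Let below_good (p : borel m.+1 * borel m.+1) :
  ~ (below F p \/ below F (p.2, p.1) \/ degenerate p) -> good [tuple p.1; p.2].
Proof.
case: p => x y /= H.
have x0 : (0 < hgt x)%R by rewrite ltNge; apply/negP => h; apply: H; right; right; left; left.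
have y0 : (0 < hgt y)%R by rewrite ltNge; apply/negP => h; apply: H; right; right; left; right.
have xy : hgt x != hgt y by apply/eqP => h; apply: H; right; right; right => /=; rewrite h.
have key (z w : 'rV[R]_m.+1) : (0 < hgt z)%R -> (0 < hgt w)%R -> hgt z != hgt w ->
    ~ below F (z, w) -> range (tnth [tuple x; y]) = [set z] `|` [set w] ->
    boundary (convex_hull (range (tnth [tuple x; y]) `|` floor_set F)) z.
  move=> z0 w0 zw nb ->; split.
    by apply: subset_closure; apply: sub_convex_hull; left; left.
  move=> hz; apply: nb; apply: cone_shadow => //; first exact: ltW.
  exact: (interior_hull_cone F0 vF _ hz).
move=> [[|[|//]] ?]; rewrite (tnth_nth x)/=.
  by apply: (key x y x0 y0 xy _ (range_pair x y)) => h; apply: H; left.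
have yx : hgt y != hgt x by rewrite eq_sym.
have rC : range (tnth [tuple x; y]) = [set y] `|` [set x] by rewrite range_pair setUC.
by apply: (key y x y0 x0 yx _ rC) => h; apply: H; right; left.
Qed.

(** The law lives on the whole space; the positive part makes the integrand nonnegative everywhere
    and equals the height on [K]. *)
Definition excess (x : borel m.+1) : R := (Num.max (hgt x) 0)%R.

Lemma measurable_excess : measurable_fun setT excess.
Proof. by apply: measurable_maxr => //; exact: measurable_hgt. Qed.

Definition mean_height := \int[ulaw mK K1]_x (excess x)%:E.

Let mB G : measurable (G : set (borel m)) ->
  measurable (below G : set (borel m.+1 * borel m.+1)).
Proof. exact: measurable_below. Qed.

Let mBT G : measurable (G : set (borel m)) ->
  measurable ([set p | below G (p.2, p.1)] : set (borel m.+1 * borel m.+1)).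
Proof.
move=> mG.
have ms : measurable_fun setT (fun p : borel m.+1 * borel m.+1 => (p.2, p.1)).
  by apply/measurable_fun_pairP; split; [exact: measurable_snd|exact: measurable_fst].
by rewrite -[X in measurable X]setTI; exact: (ms measurableT _ (mB mG)).
Qed.

(** For [x] in [K], convexity puts the cone over [G] with apex [x] inside [K], so a uniform point
    falls into it with probability [hgt x / m.+1]. The set [G] will be both [F] and its interior. *)
Let below_prob_swap G : measurable (G : set (borel m)) -> Vol G = 1 -> G `<=` F ->
  (P \x P) [set p | below G (p.2, p.1)] = (m.+1%:R^-1)%:E * mean_height.
Proof.
move=> mG G1 GF.
have me : measurable_fun setT (fun x => (excess x)%:E : \bar R).
  by apply/measurable_EFinP; exact: measurable_excess.
have e0 x : 0 <= (excess x)%:E by rewrite lee_fin le_max lexx orbT.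
have i0 : 0 <= (m.+1%:R^-1)%:E :> \bar R by rewrite lee_fin invr_ge0.
rewrite /mean_height -(ge0_integralZl (ulaw mK K1) measurableT me (fun x _ => e0 x) i0).
rewrite /product_measure1; apply: ulaw_ae.
- exact: (measurable_fun_xsection _ (mBT mG)).
- exact: measurable_funeM.
move=> x Kx; rewrite /excess max_l ?K0// -EFinM mulrC -(Vol_below mG G1 (K0 Kx)).
rewrite /P /ulaw /= /mrestr /vol; congr Vol; apply/seteqP; split => y.
  by move=> [+ _]; rewrite /xsection/= inE.
move=> /= bl; split; first by rewrite /xsection/= inE.
apply: (cone_sub vK FK Kx); apply: shadow_cone; first by case: bl.
by apply: GF; case: bl.
Qed.

Let below_prob G : measurable (G : set (borel m)) -> Vol G = 1 -> G `<=` F ->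
  (P \x P) (below G) = (m.+1%:R^-1)%:E * mean_height.
Proof. by move=> mG G1 GF; rewrite product_measure_swap ?below_prob_swap//; exact: mB. Qed.

Let P_floor : P [set x | (hgt x <= 0)%R] = 0.
Proof.
apply/eqP; rewrite eq_le measure_ge0 andbT -(Vol_hyperplane 0%R (m := m)).
have mh := @measurable_hgt_le R m 0%R.
rewrite /P /ulaw /= /mrestr; apply: Vol_le; first exact: measurableI.
  by rewrite -[X in measurable X]setTI; exact: (measurable_hgt measurableT (measurable_set1 0%R)).
by move=> x /= [x0 Kx]; apply/eqP; rewrite eq_le x0 K0.
Qed.

Let degenerate_null : measurable degenerate /\ (P \x P) degenerate = 0.
Proof.
have m1 : measurable_fun setT (fun p : borel m.+1 * borel m.+1 => hgt p.1).
  exact: (measurableT_comp measurable_hgt measurable_fst).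
have m2 : measurable_fun setT (fun p : borel m.+1 * borel m.+1 => hgt p.2).
  exact: (measurableT_comp measurable_hgt measurable_snd).
have mA := @measurable_hgt_le R m 0%R.
have mZ1 : measurable [set p : borel m.+1 * borel m.+1 | (hgt p.1 <= 0)%R].
  by rewrite -[X in measurable X]setTI;
    exact: (@measurable_fst _ _ (borel m.+1) (borel m.+1) measurableT _ mA).
have mZ2 : measurable [set p : borel m.+1 * borel m.+1 | (hgt p.2 <= 0)%R].
  by rewrite -[X in measurable X]setTI;
    exact: (@measurable_snd _ _ (borel m.+1) (borel m.+1) measurableT _ mA).
have mZ3 : measurable [set p : borel m.+1 * borel m.+1 | hgt p.2 = hgt p.1].
  rewrite (_ : mkset _ = (fun p : borel m.+1 * borel m.+1 => hgt p.2 == hgt p.1) @^-1` [set true]).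
    by rewrite -[X in measurable X]setTI; exact: (measurable_fun_eqr m2 m1 measurableT).
  by apply/seteqP; split => p /= /eqP.
have mZ12 := measurableU _ _ mZ1 mZ2.
split; first exact: measurableU.
have nul (A : set (borel m.+1 * borel m.+1)) :
    (forall x, P (xsection A x) = 0) -> (P \x P) A = 0.
  by move=> A0; rewrite /product_measure1 integral0_eq// => x _ /=.
apply/eqP; rewrite eq_le measure_ge0 andbT.
apply: (le_trans (measureU2 (P \x P) mZ12 mZ3)).
rewrite [X in _ + X](_ : _ = 0) ?adde0; last first.
  apply: nul => x; apply/eqP; rewrite eq_le measure_ge0 andbT.
  rewrite -(Vol_hyperplane (hgt x) (m := m)) /P /ulaw /= /mrestr; apply: Vol_le.
  - by apply: measurableI => //; exact: measurable_xsection.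
  - by rewrite -[X in measurable X]setTI; exact: (measurable_hgt measurableT (measurable_set1 _)).
  - by move=> y [+ _]; rewrite /xsection/= inE.
apply: (le_trans (measureU2 (P \x P) mZ1 mZ2)).
rewrite [X in _ + X](_ : _ = 0) ?adde0; last first.
  apply: nul => x; rewrite -[RHS]P_floor; congr (P _).
  by apply/seteqP; split => y; rewrite /xsection/= inE.
have z1 : (P \x P) [set p | (hgt p.1 <= 0)%R] = 0.
  rewrite product_measure_swap//; apply: nul => x; rewrite -[RHS]P_floor; congr (P _).
  by apply/seteqP; split => y; rewrite /xsection/= inE.
by rewrite [X in X <= _](_ : _ = 0).
Qed.

Lemma mean_height_bound (M : R) : (0 <= M)%R -> (forall x, K x -> (hgt x <= M)%R) ->
  mean_height <= M%:E.
Proof.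
move=> M0 KM; apply: (@le_trans _ _ (\int[ulaw mK K1]_x M%:E)); last first.
  by rewrite integral_cst//= probability_setT mule1.
(* The bound [M] is known on [K] only, so the integrand is first replaced by its minimum with
   [M]. *)
rewrite /mean_height (@ulaw_ae _ _ _ _ _ _ (fun x => (Num.min (excess x) M)%:E)).
- apply: ge0_le_integral => //.
  + by move=> x _; rewrite lee_fin le_min M0 andbT le_max lexx orbT.
  + by apply/measurable_EFinP; apply: measurable_minr => //; exact: measurable_excess.
  + by move=> x _; rewrite lee_fin ge_min lexx orbT.
- by apply/measurable_EFinP; exact: measurable_excess.
- by apply/measurable_EFinP; apply: measurable_minr => //; exact: measurable_excess.
- by move=> x Kx; rewrite min_l// ge_max M0 andbT KM.
Qed.

Lemma mean_height_fin : compact K -> mean_height \is a fin_num.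
Proof.
move=> cK; have [M M0 KM] := compact_coord_bounded cK.
rewrite ge0_fin_numE; last first.
  by apply: integral_ge0 => x _; rewrite lee_fin le_max lexx orbT.
apply: (le_lt_trans (mean_height_bound (ltW M0) _)); last exact: ltry.
by move=> x Kx; rewrite (le_trans (ler_norm _))//; exact: KM.
Qed.

(** If the mean were 0, almost every point would have height at most 0, while [K] meets these
    heights only in a null part of a hyperplane. *)
Lemma mean_height_gt0 : 0 < mean_height.
Proof.
have e0 x : 0 <= (excess x)%:E by rewrite lee_fin le_max lexx orbT.
have me : measurable_fun setT (fun x => (excess x)%:E : \bar R).
  by apply/measurable_EFinP; exact: measurable_excess.
rewrite lt_neqAle integral_ge0// andbT; apply/negP => /eqP mh0.
have : \int[ulaw mK K1]_x `|(excess x)%:E| = 0.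
  by rewrite [RHS]mh0; apply: eq_integral => x _; rewrite gee0_abs.
move/(ae_eq_integral_abs (ulaw mK K1) measurableT me) => [N [mN N0 excN]].
have mA := @measurable_hgt_le R m 0%R.
have : P setT <= P N + P [set x | (hgt x <= 0)%R].
  apply: (le_trans _ (measureU2 (ulaw mK K1) mN mA)).
  apply: (@le_measure _ _ _ (ulaw mK K1)); rewrite ?inE//; first exact: measurableU.
  move=> x _; have [x0|x0] := leP (hgt x) 0%R; first by right.
  left; apply: excN => /= /(_ I) => -[]; rewrite /excess max_l ?ltW// => hx0.
  by move: x0; rewrite hx0 ltxx.
rewrite P_floor (_ : P N = 0)// adde0.
by rewrite (_ : P setT = 1) ?lee_fin ?ler10//; exact: probability_setT.
Qed.

(* Up to null sets, the event fails iff one of the two points lies in the cone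
   spanned by the floor and the other one, and the cone of apex [y] has volume
   [hgt y / m.+1]. *)
Lemma Q2E : compact K -> Q F K 2 = 1 - (2 / m.+1%:R)%:E * mean_height.
Proof.
move=> cK; rewrite /Q (uniform_lawE mK K1).
have mF : measurable (F : set (borel m)) by exact: compact_measurable_rV.
have mI : measurable (F° : set (borel m)) by apply: open_measurable_rV; exact: open_interior.
have I1 : Vol F° = 1 by rewrite Vol_interior// F1.
have fin := mean_height_fin cK.
pose h := fine mean_height.
have hE : mean_height = h%:E by rewrite fineK.
have half : (m.+1%:R^-1)%:E * mean_height = (m.+1%:R^-1 * h)%:E by rewrite hE.
have two : (2 / m.+1%:R)%:E * mean_height = (m.+1%:R^-1 * h + m.+1%:R^-1 * h)%:E.
  by rewrite hE -EFinM; congr (_%:E); rewrite -mulrA mulr_natl mulr2n.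
rewrite two; have [mD D0] := degenerate_null.
have PPC A : measurable A -> (P \x P) (~` A) = 1 - (P \x P) A.
  by move=> mA; exact: (probability_setC (P \x P)).
apply/eqP; rewrite eq_le; apply/andP; split.
  (* Upper bound: the event avoids both cones over the interior of the floor. They are disjoint,
     since each forces a strict order of the heights, so their probabilities add up exactly. *)
  pose B := below F° `|` [set p | below F° (p.2, p.1)].
  have mBB : measurable (B : set (borel m.+1 * borel m.+1)).
    by apply: measurableU; [exact: mB|exact: mBT].
  have -> : 1 - (m.+1%:R^-1 * h + m.+1%:R^-1 * h)%:E = (P \x P) (~` B).
    have disj : below F° `&` [set p | below F° (p.2, p.1)] = set0.
      apply/seteqP; split => // -[x y] [[/= /andP[_ xy] _] [/= /andP[_ yx] _]].
      by have := lt_trans xy yx; rewrite ltxx.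
    have uB : (P \x P) B = (P \x P) (below F°) + (P \x P) [set p | below F° (p.2, p.1)].
      exact: (measureU (P \x P) (mB mI) (mBT mI) disj).
    have IF : F° `<=` F by exact: interior_subset.
    by rewrite PPC// uB (below_prob mI I1 IF) (below_prob_swap mI I1 IF) half.
  apply: tuple_measure2_le; first exact: measurableC.
  by move=> p /good_below[h1 h2] [].
(* Lower bound: outside the cones over all of [F] and the degenerate pairs the event holds.
   Subadditivity suffices here. *)
pose B := below F `|` [set p | below F (p.2, p.1)] `|` degenerate.
have mBB' : measurable (below F `|` [set p | below F (p.2, p.1)] : set (borel m.+1 * borel m.+1)).
  by apply: measurableU; [exact: mB|exact: mBT].
have mBB : measurable (B : set (borel m.+1 * borel m.+1)) by exact: measurableU.
apply: (@le_trans _ _ ((P \x P) (~` B))).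
  rewrite PPC// leeB//.
  have u1 : (P \x P) B <= (P \x P) (below F `|` [set p | below F (p.2, p.1)])
      + (P \x P) degenerate := measureU2 (P \x P) mBB' mD.
  have u2 : (P \x P) (below F `|` [set p | below F (p.2, p.1)]) <=
      (P \x P) (below F) + (P \x P) [set p | below F (p.2, p.1)] :=
    measureU2 (P \x P) (mB mF) (mBT mF).
  have FF : F `<=` F by [].
  apply: (le_trans u1); rewrite D0 adde0; apply: (le_trans u2).
  by rewrite (below_prob mF F1 FF) (below_prob_swap mF F1 FF) half.
apply: tuple_measure2_ge; first exact: measurableC.
move=> p nB; apply: below_good => -[h1|[h1|h1]]; apply: nB.
- by left; left.
- by left; right.
- by right.
Qed.

End two_points.

(** * Stochastic domination by the mountain *)

Section domination.
Context {R : realType} {m : nat}.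
Local Open Scope ereal_scope.
Local Notation borel n := (borel_rV (R := R) n).
Local Notation leb := (@lebesgue_measure R).

Lemma Vol_le_slices n (A B : set 'rV[R]_n.+1) : measurable (A : set (borel n.+1)) ->
  measurable (B : set (borel n.+1)) ->
  (forall t, Vol [set v | A (ins ord_max t v)] <= Vol [set v | B (ins ord_max t v)]) ->
  Vol A <= Vol B.
Proof.
move=> mA mB AB; rewrite !Vol_last//; apply: ge0_le_integral => //.
- by move=> t _; exact: Vol_ge0.
- exact: measurable_fun_vol_sect.
- exact: measurable_fun_vol_sect.
Qed.

(** The mean of a nonnegative variable is the integral of its tail, so dominated tails give a
    smaller mean. At levels [r >= 0], [excess] and [hgt] have the same tail. *)
Lemma mean_height_tail (K : set 'rV[R]_m.+1) (mK : measurable (K : set (borel m.+1)))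
  (K1 : Vol K = 1) : exists X : {RV (ulaw mK K1) >-> R},
  mean_height mK K1 = \int[leb]_(r in `[0%R, +oo[) ccdf X r /\
  (forall r, (0 <= r)%R -> ccdf X r = Vol ([set x | (r < hgt x)%R] `&` K)).
Proof.
pose X : {RV (ulaw mK K1) >-> R} :=
  HB.pack (@excess R m) (isMeasurableFun.Build _ _ _ _ _ (@measurable_excess R m)).
exists X; split.
  rewrite -ge0_expectation_ccdf ?expectation_def//.
  by move=> x; rewrite /X/= le_max lexx orbT.
move=> r r0; rewrite /ccdf /distribution /pushforward /= /mrestr /vol; congr Vol.
apply/seteqP; split => x [] /=; rewrite in_itv/= andbT /excess lt_max;
  by rewrite [(r < 0)%R]ltNge r0 orbF.
Qed.

Lemma mean_height_le (K M : set 'rV[R]_m.+1)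
    (mK : measurable (K : set (borel m.+1))) (K1 : Vol K = 1)
    (mM : measurable (M : set (borel m.+1))) (M1 : Vol M = 1) :
  (forall r, (0 <= r)%R ->
     Vol ([set x | (r < hgt x)%R] `&` K) <= Vol ([set x | (r < hgt x)%R] `&` M)) ->
  mean_height mK K1 <= mean_height mM M1.
Proof.
move=> KM; have [X [mhX XE]] := mean_height_tail mK K1; rewrite mhX.
have [Y [mhY YE]] := mean_height_tail mM M1; rewrite mhY.
apply: ge0_le_integral => //.
- by apply: measurable_funTS; exact: ccdf_measurable.
- by apply: measurable_funTS; exact: ccdf_measurable.
- by move=> r /=; rewrite in_itv/= andbT => r0; have := KM r r0; rewrite -XE// -YE.
Qed.

Lemma compact_homothety n (A : set 'rV[R]_n) (c : R) : c != 0%R -> compact A ->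
  compact [set v | A (c *: v)].
Proof.
move=> c0 cA; have -> : [set v | A (c *: v)] = [set c^-1 *: v | v in A].
  apply/seteqP; split => [v Av|_ [v Av <-]] /=.
    by exists (c *: v) => //; rewrite scalerA mulVf ?scale1r.
  by rewrite scalerA divff ?scale1r.
apply: continuous_compact => //; apply: continuous_subspaceT.
exact: scaler_continuous.
Qed.

Lemma Vol_homothety n (A : set 'rV[R]_n) (c : R) : (0 < c)%R ->
  measurable (A : set (borel n)) -> Vol A = (c ^+ n)%:E * Vol [set v | A (c *: v)].
Proof.
move=> c0 mA; have := Vol_affine 0%R (c := c^-1) _ mA.
rewrite invr_gt0 => /(_ c0); rewrite invrK => e.
rewrite [X in _ * Vol X](_ : _ = [set x | A (c *: (x - 0))])%R; last first.
  by apply/seteqP; split => x /=; rewrite subr0.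
by rewrite e muleA -EFinM -exprMn divff ?gt_eqF// expr1n mul1e.
Qed.

(* Brunn-Minkowski, applied to the floor and to the slices at heights [u < t]:
   a slice at height [t] of linear size at least [rho] forces the slices below
   it to have linear size at least the interpolation between [1] and [rho]. *)
Lemma slice_lower_bound (F : set 'rV[R]_m) (K : set 'rV[R]_m.+1) (u t rho : R) :
  compact F -> convex_set F -> Vol F = 1 -> compact K -> convex_set K ->
  floor_set F `<=` K -> (0 < u < t)%R -> (0 < rho)%R ->
  (rho ^+ m)%:E <= Vol [set v | K (ins ord_max t v)] ->
  ((1 - u / t + u / t * rho) ^+ m)%:E <= Vol [set v | K (ins ord_max u v)].
Proof.
move=> cF vF F1 cK vK FK /andP[u0 ut] rho0 hrho.
have t0 := lt_trans u0 ut.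
pose l := (u / t)%R.
have l0 : (0 < l)%R by rewrite divr_gt0.
have l1 : (l < 1)%R by rewrite ltr_pdivrMr// mul1r.
have l1' : (0 < 1 - l)%R by rewrite subr_gt0.
pose s := (1 - l + l * rho)%R; rewrite -/l -/s.
have s0 : (0 < s)%R by rewrite addr_gt0// mulr_gt0.
have mS (r : R) : measurable ([set v | K (ins ord_max r v)] : set (borel m)).
  by apply: compact_measurable_rV; exact: compact_sect.
have hB := Vol_homothety rho0 (mS t).
have hC := Vol_homothety s0 (mS u).
have B1 : 1%:E <= Vol [set v | K (ins ord_max t (rho *: v))].
  rewrite -(@lee_pmul2l _ (rho ^+ m)%:E)//; last by rewrite lte_fin exprn_gt0.
  by rewrite mule1 (le_trans hrho)// [leLHS]hB.
(* With both slices rescaled, all volumes involved are compared with 1. Dividing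
   [(1 - l) x + l rho y] by the sum [s] of its coefficients turns it into a convex combination of
   weight [l * rho / s], so the multiplicative inequality yields the additive one. *)
have := @brunn_minkowski_mul R m F [set v | K (ins ord_max t (rho *: v))]
  [set v | K (ins ord_max u (s *: v))] (l * rho / s)%R 1%R 1%R.
rewrite !powR1 mul1r => BM.
rewrite hC -[leLHS]mule1 lee_pmul2l//; last by rewrite lte_fin exprn_gt0.
have w : (1 - l * rho / s = (1 - l) / s)%R.
  by rewrite /s; field; rewrite gt_eqF.
apply: BM => //.
- apply/andP; split; first by rewrite divr_gt0// mulr_gt0.
  by rewrite ltr_pdivrMr// mul1r /s ltrDr.
- apply: (compact_homothety (A := [set v | K (ins ord_max t v)])).
    by rewrite gt_eqF.
  exact: compact_sect.
- apply: (compact_homothety (A := [set v | K (ins ord_max u v)])).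
    by rewrite gt_eqF.
  exact: compact_sect.
- apply/convex_setP => x y a a01 /= Kx Ky.
  have := (convex_setP _).1 (convex_sect (k := ord_max) (s := t) vK) _ _ _ a01 Kx Ky.
  by rewrite /= scalerDr !scalerA [(rho * _)%R]mulrC [(rho * a)%R]mulrC.
- move=> x y Fx Ky /=; rewrite w scalerDr !scalerA.
  have -> : (s * ((1 - l) / s) = 1 - l)%R by field; rewrite gt_eqF.
  have -> : (s * (l * rho / s) = l * rho)%R by field; rewrite gt_eqF.
  have -> : ins ord_max u ((1 - l) *: x + (l * rho) *: y) =
      ((1 - l) *: ins ord_max 0 x + l *: ins ord_max t (rho *: y))%R.
    rewrite !insZ insD mulr0 add0r scalerA; congr ins.
    by rewrite /l divfK ?gt_eqF.
  move/convex_setP : vK; apply => //; first by rewrite (ltW l0) (ltW l1).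
  by apply: FK; rewrite floor_setE; exists x.
- by rewrite F1.
Qed.

(** The mountain enters through [below], without base and apex, so that its slices are exact
    homothets of [F]. *)
Lemma tail_le (F : set 'rV[R]_m) (K : set 'rV[R]_m.+1) (z : 'rV[R]_m.+1) (r : R) :
  (0 < m)%N -> compact F -> convex_set F -> Vol F = 1 -> compact K -> convex_set K ->
  floor_set F `<=` K -> Vol K = 1 -> hgt z = m.+1%:R%R -> (0 <= r)%R ->
  Vol ([set x | (r < hgt x)%R] `&` K) <=
  Vol ([set x | (r < hgt x)%R] `&` [set x | below F (x, z)]).
Proof.
move=> m0 cF vF F1 cK vK FK K1 hz r0.
have mF : measurable (F : set (borel m)) by exact: compact_measurable_rV.
have mK : measurable (K : set (borel m.+1)) by exact: compact_measurable_rV.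
pose B := [set x | below F (x, z)].
have mB : measurable (B : set (borel m.+1)) by exact: measurable_below_sect.
have B1 : Vol B = 1.
  by rewrite Vol_below// hz ?ler0n// divff.
pose d : R := m.+1%:R; have d0 : (0 < d)%R by rewrite ltr0n.
(* The slice volume of the mountain; as [m] is positive, the power of 0 is 0 and the formula also
   covers heights from the apex upwards. *)
pose prof t := ((Num.max (1 - t / d) 0) ^+ m)%R.
have profE t : (0 < t)%R -> Vol [set v | B (ins ord_max t v)] = (prof t)%:E.
  move=> t0; rewrite /prof; have [td|td] := ltP t d.
    by rewrite max_l ?subr_ge0 ?ler_pdivrMr ?mul1r ?(ltW td)// Vol_below_slice ?hz ?t0// F1 mule1.
  rewrite max_r ?subr_le0 ?ler_pdivlMr ?mul1r// expr0n gtn_eqF//=.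
  rewrite (_ : mkset _ = set0) ?Vol_set0//; apply/seteqP; split => // v [/= h _].
  by move: h; rewrite hgt_ins hz => /andP[_]; rewrite ltNge td.
have Bneg t : (t <= 0)%R -> Vol [set v | B (ins ord_max t v)] = 0.
  move=> t0; rewrite (_ : mkset _ = set0) ?Vol_set0//; apply/seteqP; split => // v [/= h _].
  by move: h; rewrite hgt_ins ltNge t0.
have mH := @measurable_hgt_gt R m r.
have [case1|] := pselect (forall t, (r < t)%R ->
    Vol [set v | K (ins ord_max t v)] <= (prof t)%:E).
  apply: Vol_le_slices; [exact: measurableI|exact: measurableI|move=> t].
  have sl (A : set 'rV[R]_m.+1) : [set v | ([set x | (r < hgt x)%R] `&` A) (ins ord_max t v)] =
      if (r < t)%R then [set v | A (ins ord_max t v)] else set0.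
    apply/seteqP; split => v /=; rewrite hgt_ins; first by move=> [-> ].
    by case: ifP.
  rewrite !sl; case: ifPn => // rt.
  by rewrite profE ?case1// (le_lt_trans r0).
move=> /existsNP[t /not_implyP[rt /negP]]; rewrite -ltNge => ht.
have t0 : (0 < t)%R by exact: le_lt_trans rt.
(* A linear size for the slice of [K] at [t], at least that of the mountain. From the apex upwards
   any positive number does, and the minimum of 1 and the slice volume has its [m]-th power below
   that volume. *)
have [rho [rho0 rhoK rhot]] : exists rho, [/\ (0 < rho)%R,
    (rho ^+ m)%:E <= Vol [set v | K (ins ord_max t v)] & (1 - t / d <= rho)%R].
  have [td|td] := ltP 0%R (1 - t / d)%R.
    exists (1 - t / d)%R; split => //; apply: ltW; apply: le_lt_trans ht.
    by rewrite /prof max_l// ltW.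
  have fK := Vol_compact_fin (@compact_sect _ _ ord_max t _ cK).
  have a0 : (0 < fine (Vol [set v | K (ins ord_max t v)]))%R.
    rewrite -lte_fin fineK//; apply: le_lt_trans ht.
    by rewrite lee_fin exprn_ge0// le_max lexx orbT.
  have min0 : (0 < Num.min 1 (fine (Vol [set v | K (ins ord_max t v)])))%R.
    by rewrite lt_min ltr01 a0.
  exists (Num.min 1 (fine (Vol [set v | K (ins ord_max t v)])))%R; split => //.
    rewrite -[leRHS]fineK// lee_fin.
    apply: (@le_trans _ _ (Num.min 1 (fine (Vol [set v | K (ins ord_max t v)])))%R).
      by rewrite -[leRHS]expr1; apply: ler_wiXn2l; rewrite ?(ltW min0)// ge_min lexx.
    by rewrite ge_min lexx orbT.
  exact: le_trans (ltW min0).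
have sl (A : set 'rV[R]_m.+1) t' : [set v | ([set x | (hgt x <= r)%R] `&` A) (ins ord_max t' v)] =
    if (t' <= r)%R then [set v | A (ins ord_max t' v)] else set0.
  apply/seteqP; split => v /=; rewrite hgt_ins; first by move=> [-> ].
  by case: ifP.
have HC : [set x : 'rV[R]_m.+1 | (hgt x <= r)%R] = ~` [set x | (r < hgt x)%R].
  by apply/seteqP; split => x /=; rewrite leNgt => /negP.
have mHC := @measurable_hgt_le R m r.
have low : Vol ([set x | (hgt x <= r)%R] `&` B) <= Vol ([set x | (hgt x <= r)%R] `&` K).
  apply: Vol_le_slices; [exact: measurableI|exact: measurableI|move=> u].
  rewrite !sl; case: ifPn => // ur.
  have [u0|u0] := leP u 0%R; first by rewrite Bneg// Vol_ge0.
  have ut : (u < t)%R by exact: le_lt_trans rt.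
  rewrite profE//; apply: le_trans (slice_lower_bound cF vF F1 cK vK FK _ rho0 rhoK); last first.
    by rewrite u0 ut.
  have ut0 : (0 <= u / t)%R by rewrite divr_ge0// ltW.
  have ut1 : (u / t <= 1)%R by rewrite ler_pdivrMr// mul1r ltW.
  rewrite lee_fin; apply: lerXn2r; rewrite ?nnegrE.
  - by rewrite le_max lexx orbT.
  - by rewrite addr_ge0 ?subr_ge0// mulr_ge0// ltW.
  rewrite ge_max; apply/andP; split.
    (* The linear size of the mountain is affine in the height, so interpolating between 1 at the
       floor and [1 - t / d] at [t] gives exactly [1 - u / d] at [u]. *)
    apply: (@le_trans _ _ (1 - u / t + u / t * (1 - t / d)))%R; last first.
      by rewrite lerD2l ler_wpM2l.
    by rewrite le_eqVlt; apply/orP; left; apply/eqP; field; rewrite !gt_eqF.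
  by rewrite addr_ge0 ?subr_ge0// mulr_ge0// ltW.
(* Both bodies have volume 1, so the comparison below [r] turns into the opposite comparison above
   [r]. *)
have splitH (A : set 'rV[R]_m.+1) : measurable (A : set (borel m.+1)) -> Vol A = 1 ->
    exists a b, [/\ Vol ([set x | (r < hgt x)%R] `&` A) = a%:E,
      Vol ([set x | (hgt x <= r)%R] `&` A) = b%:E & (a + b = 1)%R].
  move=> mA A1.
  have fin (S : set 'rV[R]_m.+1) : measurable (S : set (borel m.+1)) ->
      exists a, Vol (S `&` A) = a%:E.
    move=> mS; exists (fine (Vol (S `&` A))); rewrite fineK//.
    rewrite ge0_fin_numE ?Vol_ge0//; apply: (@le_lt_trans _ _ (Vol A)); last by rewrite A1 ltry.
    by apply: Vol_le => //; exact: measurableI.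
  have [a aE] := fin _ mH; have [b bE] := fin _ mHC.
  exists a, b; split => //; apply: EFin_inj; rewrite EFinD -aE -bE -A1.
  have mHA : measurable ([set x | (r < hgt x)%R] `&` A : set (borel m.+1)) by exact: measurableI.
  have mCA : measurable ([set x | (hgt x <= r)%R] `&` A : set (borel m.+1)) by exact: measurableI.
  have U : ([set x | (r < hgt x)%R] `&` A) `|` ([set x | (hgt x <= r)%R] `&` A) = A.
    by rewrite -setIUl HC setUv setTI.
  have D : ([set x | (r < hgt x)%R] `&` A) `&` ([set x | (hgt x <= r)%R] `&` A) = set0.
    by rewrite setIACA HC setICr set0I.
  by have := measureU (@vol R m.+1) mHA mCA D; rewrite /vol U => e; exact: esym e.
have [a [a' [aE a'E aa']]] := splitH _ mK K1.
have [b [b' [bE b'E bb']]] := splitH _ mB B1.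
rewrite aE bE lee_fin; move: low; rewrite a'E b'E lee_fin.
by lra.
Qed.

End domination.

(** * Frustums *)

Section frustum.
Context {R : realType} {m : nat}.
Variables (F : set 'rV[R]_m).
Hypotheses (cF : compact F) (vF : convex_set F) (F1 : Vol F = 1%E).
Local Notation borel n := (borel_rV (R := R) n).
Local Notation leb := (@lebesgue_measure R).

(** The slice at height [t] is [(1 + a t) F] translated by [t w]. Negative [a] with [1 + a k = 0]
    gives a cone with apex at height [k]; positive [a] gives a body that widens upwards. *)
Definition frustum (a k : R) (w : 'rV[R]_m) : set 'rV[R]_m.+1 :=
  [set ins ord_max p.2 ((1 + a * p.2) *: p.1 + p.2 *: w) | p in F `*` `[0, k]%classic].

Lemma frustum_compact a k w : compact (frustum a k w).
Proof.
apply: continuous_compact; last by apply: compact_setX => //; exact: segment_compact.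
apply: continuous_subspaceT.
have cc c : continuous ((fun=> c) : 'rV[R]_m * R -> R).
  by move=> p; exact: (@cvg_cst _ c _ (nbhs p) _).
have c1 : continuous (fun p : 'rV[R]_m * R => p.1) by move=> p; exact: cvg_fst.
have c2 : continuous (fun p : 'rV[R]_m * R => p.2) by move=> p; exact: cvg_snd.
apply: (continuous_ins c2); apply: continuous_rV => i.
have -> : (fun p : 'rV[R]_m * R => ((1 + a * p.2) *: p.1 + p.2 *: w) ord0 i) =
    (fun p => (1 + a * p.2) * p.1 ord0 i + p.2 * w ord0 i).
  by apply/funext => p; rewrite !mxE.
have c3 : continuous (fun p : 'rV[R]_m * R => p.1 ord0 i).
  move=> p; exact: (@continuous_comp _ _ _ (fun p : 'rV[R]_m * R => p.1)
    (fun v : 'rV[R]_m => v ord0 i) p (c1 p) (@coord_continuous R 1 m ord0 i p.1)).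
move=> p; exact: (continuousD
  (continuousM (continuousD (cc 1 p) (continuousM (cc a p) (c2 p))) (c3 p))
  (continuousM (c2 p) (cc (w ord0 i) p))).
Qed.

(** The scale [1 + a t] is affine in the height and nonnegative up to [k], so the scaled points of
    [F] combine with exactly the scale of the intermediate height. *)
Lemma frustum_convex a k w : 0 <= k -> 0 <= 1 + a * k -> convex_set (frustum a k w).
Proof.
move=> k0 ak; apply/convex_setP => p q l /andP[l0 l1].
move=> [[f s] [/= Ff]]; rewrite in_itv/= => /andP[s0 sk] <-.
move=> [[g t] [/= Fg]]; rewrite in_itv/= => /andP[t0 tk] <-.
have pos r : 0 <= r -> r <= k -> 0 <= 1 + a * r.
  move=> r0 rk; have [a0|a0] := leP 0 a; first by rewrite addr_ge0// mulr_ge0.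
  by apply: le_trans ak _; rewrite lerD2l ler_wnM2l// ltW.
have [] := @convex_conic _ _ F ((1 - l) * (1 + a * s)) (l * (1 + a * t)) f g vF.
- by rewrite mulr_ge0 ?subr_ge0 ?pos.
- by rewrite mulr_ge0 ?pos.
- by [].
- by [].
move=> r Fr rE; exists (r, (1 - l) * s + l * t) => /=.
  split => //=; rewrite in_itv/=; apply/andP; split.
    by rewrite addr_ge0// mulr_ge0// subr_ge0.
  have h1 : (1 - l) * s <= (1 - l) * k by rewrite ler_wpM2l// subr_ge0.
  have h2 : l * t <= l * k by rewrite ler_wpM2l.
  by rewrite (_ : k = (1 - l) * k + l * k) ?lerD//; ring.
rewrite !insZ insD; congr ins; rewrite !scalerDr !scalerA addrACA rE -scalerDl.
by congr (_ *: _ + _ *: _); ring.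
Qed.

Lemma frustum_floor a k w : 0 <= k -> has_floor F (frustum a k w).
Proof.
move=> k0; split.
  by move=> x [[f t] [/= Ff]]; rewrite in_itv/= => /andP[t0 tk] <-; rewrite /= ins_at.
rewrite floor_setE; apply/seteqP; split => x.
  move=> [[[f t] [/= Ff tk] <-]]; rewrite ins_at => ->.
  by exists f => //; rewrite mulr0 addr0 scale1r scale0r addr0.
move=> [f Ff <-]; split; last by rewrite /= ins_at.
exists (f, 0); first by split => //=; rewrite in_itv/= lexx.
by rewrite /= mulr0 addr0 scale1r scale0r addr0.
Qed.

Lemma Vol_frustum a k w : 0 < k -> a != 0 -> 0 <= 1 + a * k ->
  Vol (frustum a k w) = (((1 + a * k) ^+ m.+1 - 1) / (a * m.+1%:R))%:E.
Proof.
move=> k0 a0 ak.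
have mS : measurable (frustum a k w : set (borel m.+1)).
  by apply: compact_measurable_rV; exact: frustum_compact.
rewrite Vol_last//.
pose s (t : R) := Vol [set v | frustum a k w (ins ord_max t v)].
have ms : measurable_fun setT s by exact: measurable_fun_vol_sect.
transitivity (\int[leb]_(t in `[0%R, k]) s t)%E.
  rewrite [RHS]integral_mkcond; apply: eq_integral => t _; rewrite patchE.
  case: ifPn => // /negP tk; rewrite (_ : mkset _ = set0) ?Vol_set0//.
  apply/seteqP; split => // v [[f u] [/= _ uk] /(congr1 hgt)].
  by rewrite !hgt_ins => ut; apply: tk; rewrite inE -ut.
(* Endpoints are dropped because the scale [1 + a k] may be 0 at the top, where the slice could not
   be rescaled to [F]. *)
rewrite (@integral_itv_bndoo _ 0 k s true false); last first.
  exact: measurable_funTS.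
have := @integral_affine_pow R 1 a k m k0 a0; rewrite expr1n => <-.
rewrite [RHS](@integral_itv_bndoo _ 0 k _ true false); last first.
  apply/measurable_EFinP; apply: measurable_funTS; apply: measurable_funX.
  by apply: measurable_funD => //; exact: measurable_funM.
apply: eq_integral => t /set_mem/=; rewrite in_itv/= => /andP[t0 tk].
have at0 : 0 < 1 + a * t.
  have [a1|a1] := leP 0 a; first by rewrite ltr_wpDr// mulr_ge0// ltW.
  by apply: le_lt_trans ak _; rewrite ltrD2l ltr_nM2l.
have mF : measurable (F : set (borel m)) by exact: compact_measurable_rV.
rewrite -[RHS]mule1 -F1 -(Vol_affine (t *: w) at0 mF).
rewrite /s; congr Vol; apply/seteqP; split => v /=.
  move=> [[f u] [/= Ff _] /[dup] /(congr1 hgt) + /(congr1 (@col' R 1 m.+1 ord_max))].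
  rewrite !hgt_ins !col'_ins => -> <-.
  by rewrite addrK scalerA mulVf ?scale1r// gt_eqF.
move=> Fv; exists ((1 + a * t)^-1 *: (v - t *: w), t) => /=.
  by split => //=; rewrite in_itv/= !ltW.
by rewrite scalerA divff ?gt_eqF// scale1r subrK.
Qed.

Lemma frustum_CCSF a k w : 0 < k -> a != 0 -> 0 <= 1 + a * k ->
  ((1 + a * k) ^+ m.+1 - 1) / (a * m.+1%:R) = 1 -> CCSF F (frustum a k w).
Proof.
move=> k0 a0 ak V1; split.
- exact: frustum_compact.
- by apply: frustum_convex => //; exact: ltW.
- by apply: frustum_floor; exact: ltW.
- by rewrite Vol_frustum// V1.
Qed.

Lemma cone_frustum (z : 'rV[R]_m.+1) : 0 < hgt z ->
  cone F z = frustum (- (hgt z)^-1) (hgt z) ((hgt z)^-1 *: col' ord_max z).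
Proof.
move=> z0; have zn : hgt z != 0 by rewrite gt_eqF.
have e f t : (1 - t) *: ins ord_max 0 f + t *: z =
    ins ord_max (t * hgt z) ((1 - t) *: f + t *: col' ord_max z).
  by rewrite -[in LHS](ins_col' ord_max z) !insZ insD mulr0 add0r.
apply/seteqP; split => x.
  move=> [f [t [Ff /andP[t0 t1] ->]]]; exists (f, t * hgt z) => /=.
    split => //=; rewrite in_itv/= mulr_ge0 ?(ltW z0)//=.
    by rewrite ler_piMl// ltW.
  rewrite e scalerA mulfK// (_ : 1 + _ = 1 - t)//.
  by field.
move=> [[f s] [/= Ff]]; rewrite in_itv/= => /andP[s0 sz] <-.
exists f, (s / hgt z); split => //.
  by rewrite divr_ge0 ?(ltW z0)//= ler_pdivrMr// mul1r.
rewrite e divfK// scalerA (_ : 1 + _ = 1 - s / hgt z)//.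
by field.
Qed.

Lemma mountain_CCSF (z : 'rV[R]_m.+1) : hgt z = m.+1%:R -> CCSF F (cone F z).
Proof.
move=> hz; have d0 : 0 < m.+1%:R :> R by rewrite ltr0n.
have dn : m.+1%:R != 0 :> R by rewrite gt_eqF.
rewrite cone_frustum; last by rewrite hz.
rewrite hz; apply: frustum_CCSF => //.
- by rewrite mulNr mulVf// subrr.
- by rewrite mulNr mulVf// subrr expr0n /= sub0r divff// oppr_eq0 oner_eq0.
Qed.

(** With [w = a k], the equation of volume 1 determines [k = w * m.+1 / S]. The expansion of [S]
    contains a term of order [m * w ^+ 2], hence [k <= m.+1 / (m * w) <= 2 / w], which is [e] for
    [w = 2 / e]. *)
Lemma flat_frustum (e : R) : (0 < m)%N -> 0 < e ->
  exists a k, [/\ 0 < k, k <= e & CCSF F (frustum a k 0)].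
Proof.
move=> m0 e0; have [w wE w0] : exists2 w, w = 2 / e & 0 < w.
  by exists (2 / e); rewrite ?divr_gt0.
pose S := (1 + w) ^+ m.+1 - 1; pose k := w * m.+1%:R / S.
have mR : 1 <= m%:R :> R by rewrite ler1n.
have bern : 1 + m%:R * w <= (1 + w) ^+ m.
  elim: (m) => [|j IH]; first by rewrite mul0r addr0 expr0.
  rewrite exprS; apply: (@le_trans _ _ ((1 + w) * (1 + j%:R * w))).
    rewrite -subr_ge0 -natr1 [X in 0 <= X](_ : _ = j%:R * w * w); last by ring.
    by rewrite !mulr_ge0// ltW.
  by rewrite ler_pM2l// ltr_wpDl// ltW.
have w1 : 0 < 1 + w by rewrite ltr_wpDl.
have SE : m.+1%:R * w + m%:R * w * w <= S.
  rewrite /S lerBrDr exprS; apply: (@le_trans _ _ ((1 + w) * (1 + m%:R * w))).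
    by rewrite -natr1 le_eqVlt; apply/orP; left; apply/eqP; ring.
  by rewrite ler_pM2l.
have S0 : 0 < S.
  by apply: lt_le_trans SE; rewrite ltr_pwDl ?mulr_gt0// !mulr_ge0// ltW.
have k0 : 0 < k by rewrite divr_gt0// mulr_gt0.
exists (w / k), k; split => //.
  rewrite ler_pdivrMr//; apply: (@le_trans _ _ (e * (m%:R * w * w))); last first.
    rewrite ler_pM2l//; apply: le_trans SE; rewrite lerDr mulr_ge0//; exact: ltW.
  have -> : e * (m%:R * w * w) = w * (m%:R + m%:R).
    by rewrite wE; field; rewrite gt_eqF.
  by rewrite ler_pM2l// -natr1 lerD2l.
apply: frustum_CCSF => //.
- by rewrite mulf_neq0 ?invr_eq0 ?gt_eqF.
- by rewrite divfK ?gt_eqF// ltW.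
- rewrite divfK ?gt_eqF// -/S /k; field.
  by rewrite !gt_eqF// ltr0n.
Qed.

End frustum.

(** * Extremality of mountains and bodies with probability close to 1 *)

Local Open Scope ereal_scope.

(* The ambient dimension is d = m.+1, so d >= 2 reads 0 < m. *)
Theorem theorem2 (R : realType) (m : nat) (m_gt0 : (0 < m)%N)
  (F : set 'rV[R]_m) (F_compact : compact F) (F_convex : convex_set F)
  (F_vol : Vol F = 1) :
  (forall M : set 'rV[R]_m.+1, unit_mountain F M ->
     forall K : set 'rV[R]_m.+1, CCSF F K ->
       Q F M 2 <= Q F K 2 /\ Q F K 2 < 1) /\
  (forall alpha : R, (0 < alpha)%R ->
     exists2 K : set 'rV[R]_m.+1, CCSF F K & (1 - alpha)%:E <= Q F K 2) /\
  ~ (exists2 K : set 'rV[R]_m.+1, CCSF F K & Q F K 2 = 1).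
Proof.
have F0 : F !=set0.
  apply: contrapT => F0; move: F_vol; rewrite (_ : F = set0) ?Vol_set0.
    by move/eqP; rewrite eq_sym onee_eq0.
  by apply/seteqP; split => // x Fx; apply: F0; exists x.
have QE (K : set 'rV[R]_m.+1) : CCSF F K ->
    exists (mK : measurable (K : set (borel_rV m.+1))) (K1 : Vol K = 1),
    [/\ Q F K 2 = 1 - (2 / m.+1%:R)%:E * mean_height mK K1,
      mean_height mK K1 \is a fin_num, 0 < mean_height mK K1,
      floor_set F `<=` K & forall x, K x -> (0 <= hgt x)%R].
  move=> [cK vK [K0 KF] K1].
  have mK : measurable (K : set (borel_rV m.+1)) by exact: compact_measurable_rV.
  have FK : floor_set F `<=` K by rewrite -KF; exact: subIsetl.
  exists mK, K1; split => //; first exact: Q2E.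
    exact: mean_height_fin.
  exact: (@mean_height_gt0 _ _ K mK K0 K1).
have c0 : (0 < 2 / m.+1%:R :> R)%R by rewrite divr_gt0.
have lt1 (K : set 'rV[R]_m.+1) : CCSF F K -> Q F K 2 < 1.
  move=> /QE[mK [K1 [-> fin h0 _ _]]].
  rewrite -[mean_height mK K1]fineK// -EFinM -EFinB lte_fin gtrBl mulr_gt0//.
  by rewrite -lte_fin fineK.
split; [|split].
- move=> M [z hz ->] K KC; split; last exact: lt1.
  rewrite convex_hull_cone//; have MC := mountain_CCSF F_compact F_convex F_vol hz.
  have [mK [K1 [-> finK _ FK _]]] := QE _ KC.
  have [mM [M1 [-> finM _ _ _]]] := QE _ MC.
  (* [Q] decreases with the mean height, so it remains to compare the tails of the heights. *)
  rewrite leeB// lee_pmul2l//.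
  apply: mean_height_le => r r0; have [cK vK _ _] := KC.
  apply: (le_trans (tail_le m_gt0 F_compact F_convex F_vol cK vK FK K1 hz r0)).
  have mF : measurable (F : set (borel_rV m)) by exact: compact_measurable_rV.
  have mH := @measurable_hgt_gt R m r.
  apply: Vol_le.
  + by apply: measurableI => //; exact: measurable_below_sect.
  + exact: measurableI.
  + by move=> x [rx [xz Fx]]; split => //; exact: shadow_cone.
- move=> al al0; have [a [k [k0 kal KC]]] := flat_frustum F_compact F_convex F_vol m_gt0 al0.
  exists (frustum F a k 0); first by [].
  have [mK [K1 [-> finK h0 _ K0]]] := QE _ KC.
  rewrite EFinB leeB//.
  have hk : mean_height mK K1 <= k%:E.
    apply: mean_height_bound; first exact: ltW.
    move=> x [[f t] [/= Ff]]; rewrite in_itv/= => /andP[t0 tk] <-.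
    by rewrite hgt_ins.
  apply: (@le_trans _ _ ((2 / m.+1%:R)%:E * k%:E)).
    by rewrite lee_pmul2l ?lte_fin.
  (* The factor [2 / m.+1] is at most 1 because the ambient dimension is at least 2, so a frustum of
     height at most [al] is flat enough. *)
  rewrite -EFinM lee_fin; apply: le_trans kal; rewrite ler_piMl ?(ltW k0)//.
  by rewrite ler_pdivrMr// mul1r ler_nat.
- by move=> [K /lt1 + Q1]; rewrite Q1 ltxx.
Qed.
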